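(* For all integers $0<d<n$ and every $0<\tau<10^{-1}$ there exists $\varepsilon>0$ (depending only on $n,d,\tau$) such that the following holds. Let $E\subset B(0,1)\subset\mathbb{R}^n$ be a closed set containing the origin. Suppose that for every $x\in E$ and $0<r\le 10$ we are given a $d$-dimensional affine subspace $P(x,r)$ of $\mathbb{R}^n$ that contains $x$, such that $$\mathrm{dist}(y,P(x,r))\le \varepsilon r\quad\text{for } y\in E\cap B(x,r),$$ that for every $x\in E$ and every integer $k\ge 0$ $$d_{x,10^{-k}}\big(P(x,10^{-k}),P(x,10^{-k+1})\big)\le\varepsilon,$$ and that $$d_{x,10^{-k+2}}\big(P(x,10^{-k}),P(y,10^{-k})\big)\le\varepsilon$$ whenever $k\ge 0$ and $x,y\in E$ satisfy $|x-y|\le 10^{-k+2}$. Then there is a bijective mapping $g:\mathbb{R}^n\to\mathbb{R}^n$ such that $$|g(x)-x|\le\tau\ \text{ for } x\in\mathbb{R}^n,$$ $$\tfrac14|x-y|^{1+\tau}\le|g(x)-g(y)|\le 3|x-y|^{1-\tau}\ \text{ for } x,y\in\mathbb{R}^n \text{ with } |x-y|\le1,$$ and $E\subset g(P(0,10))$. Moreover, $\Sigma=g(P(0,10))$ is Reifenberg-flat, in the sense that for every $x\in\Sigma$ and $r>0$ there is an affine $d$-plane $Q(x,r)$ through $x$ such that $d_{x,r}(\Sigma,Q(x,r))\le C\varepsilon$, where $C$ depends only on $n$ and $d$.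
   Context: $B(x,r)$ is the ball of center $x$ and radius $r$ in $\mathbb{R}^n$. For sets $E,F\subset\mathbb{R}^n$ that both meet $B(x,r)$, the normalized local Hausdorff distance is $$d_{x,r}(E,F)=\frac1r\max\Big\{\sup_{y\in E\cap B(x,r)}\mathrm{dist}(y,F),\ \sup_{y\in F\cap B(x,r)}\mathrm{dist}(y,E)\Big\}.$$ *)

(* Defs.v *)
From HB Require Import structures.
From mathcomp Require Import all_boot all_order all_algebra.
From mathcomp Require Import all_classical all_reals all_analysis.

Set Implicit Arguments.
Unset Strict Implicit.
Unset Printing Implicit Defensive.

Import Order.TTheory GRing.Theory Num.Theory.
Import numFieldNormedType.Exports.

Local Open Scope classical_set_scope.
Local Open Scope ring_scope.

(* The library norm [`|x|] (and hence [ball], [closed_ball], [edist]) on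
   ['rV[R]_n] is the sup norm, so the Euclidean metric of R^n is set up here.
   The two norms induce the same topology, so the library's [closed] can be
   used for subsets of ['rV[R]_n]. *)
Definition enorm (R : realType) (n : nat) (x : 'rV[R]_n) : R :=
  Num.sqrt (\sum_(i < n) x 0 i ^+ 2).

(* B(x,r) is the closed Euclidean ball. *)
Definition eball (R : realType) (n : nat) (x : 'rV[R]_n) (r : R) :
    set 'rV[R]_n :=
  [set y | enorm (y - x) <= r].

(* Extended-real-valued, with value +oo when F is empty. *)
Definition edist_to (R : realType) (n : nat) (y : 'rV[R]_n)
    (F : set 'rV[R]_n) : \bar R :=
  ereal_inf [set (enorm (y - z))%:E | z in F].

(* The local Hausdorff distance d_{x,r}(E,F); it is a (finite) real number when
   r > 0 and both E and F meet B(x,r). *)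
Definition local_hdist (R : realType) (n : nat) (x : 'rV[R]_n) (r : R)
    (E F : set 'rV[R]_n) : \bar R :=
  ((r^-1)%:E * maxe (ereal_sup [set edist_to y F | y in E `&` eball x r])
                    (ereal_sup [set edist_to y E | y in F `&` eball x r]))%E.

Definition affine_plane (R : realType) (n d : nat) (P : set 'rV[R]_n) : Prop :=
  exists (p : 'rV[R]_n) (V : {vspace 'rV[R]_n}),
    \dim V = d /\ P = [set p + v | v in [set v | v \in V]].

(* Main.v *)
Require Import Defs.
From HB Require Import structures.
From mathcomp Require Import all_boot all_order all_algebra.
From mathcomp Require Import all_classical all_reals all_analysis.
From mathcomp Require Import ring lra.

Set Implicit Arguments.
Unset Strict Implicit.
Unset Printing Implicit Defensive.

Import Order.TTheory GRing.Theory Num.Theory.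
Import numFieldNormedType.Exports.

Local Open Scope classical_set_scope.
Local Open Scope ring_scope.

(* Write r_k = 10^-k.  Starting from S_0 = P(0,10), move the points of S_k near E to
   averages, along a partition of unity at scale r_k, of their projections onto the
   planes P(x,r_k).  On S_k, which near E is a Lipschitz graph with constant
   O(eps) over these planes, this displacement is O(eps r_k) and O(eps)-Lipschitz;
   its McShane extension D_k to R^n has the same properties, so id + D_k is a
   homeomorphism of R^n, and S_(k+1) is the image of S_k.  Projecting makes S_(k+1)
   a graph near E at scale r_(k+1) with the same constant as S_k, so that constants
   do not accumulate.  The compositions of the maps id + D_k converge to a
   homeomorphism g, with |g - id| = O(eps): at scale r_k the first k maps distort
   distances by (1 + O(eps))^k, which is absorbed by the exponent tau, and the
   others move points by O(eps r_k).  The points of S_k come within r_k of E, and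
   S_k is flat at scale r_k, so g(P(0,10)) contains E and is flat at all scales. *)

(** * Euclidean geometry of row vectors *)

(** The displacement has to be defined on S_k before it is extended: off S_k the averaged projection
    moves a point by roughly its distance to the planes, which is neither O(eps r_k) nor
    O(eps)-Lipschitz. On S_k it is bounded through the graph constant lam of S_k, whereas the
    position of S_(k+1) relative to nearby planes is bounded by eps alone; this gap is what allows
    lam to be the same multiple of eps at every scale. Away from E nothing is reset, but a point
    that has become far from E at the current scale is no longer moved, so flatness deteriorates
    there only once. In the limit, the inverse of the first k maps expands by at most 2^k while the
    remaining error is of order 10^-k. As 2/10 < 1, bijectivity of g and the inclusion of E in its
    image reduce to geometric series. The Hoelder exponents need the sharper factors (1 + O(eps))^k
    and (1 - O(eps))^k, and for the lower bound the relevant scale has to be read off from the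
    images of the two points, not from the points. *)

Section Euclid.
Context {R : realType} {n : nat}.
Implicit Types x y z u v : 'rV[R]_n.

Definition dotp x y : R := \sum_(i < n) x 0 i * y 0 i.

Lemma dotpE x y : dotp x y = (x *m y^T) 0 0.
Proof. by rewrite mxE; apply: eq_bigr => i _; rewrite mxE. Qed.

Lemma dotpC x y : dotp x y = dotp y x.
Proof. by apply: eq_bigr => i _; rewrite mulrC. Qed.

Lemma dotpDl x y z : dotp (x + y) z = dotp x z + dotp y z.
Proof. by rewrite !dotpE mulmxDl mxE. Qed.

Lemma dotpDr x y z : dotp x (y + z) = dotp x y + dotp x z.
Proof. by rewrite dotpC dotpDl !(dotpC x). Qed.

Lemma dotpZl a x y : dotp (a *: x) y = a * dotp x y.
Proof. by rewrite !dotpE -scalemxAl mxE. Qed.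

Lemma dotpZr a x y : dotp x (a *: y) = a * dotp x y.
Proof. by rewrite dotpC dotpZl dotpC. Qed.

Lemma dotp_mulmx x y (A : 'M[R]_n) : dotp (x *m A) y = dotp x (y *m A^T).
Proof. by rewrite !dotpE trmx_mul trmxK mulmxA. Qed.

Lemma dotp_ge0 x : 0 <= dotp x x.
Proof. by apply: sumr_ge0 => i _; rewrite -expr2 sqr_ge0. Qed.

Lemma enormE x : enorm x = Num.sqrt (dotp x x).
Proof. by rewrite /enorm; congr Num.sqrt; apply: eq_bigr => i _; rewrite expr2. Qed.

Lemma enorm_ge0 x : 0 <= enorm x. Proof. exact: sqrtr_ge0. Qed.

Lemma enorm_sqr x : enorm x ^+ 2 = dotp x x.
Proof. by rewrite enormE sqr_sqrtr ?dotp_ge0. Qed.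

Lemma enorm0 : enorm (0 : 'rV[R]_n) = 0.
Proof. by rewrite /enorm big1 ?sqrtr0 // => i _; rewrite mxE expr0n. Qed.

Lemma normr_coord x i : `|x 0 i| <= enorm x.
Proof.
rewrite /enorm -sqrtr_sqr ler_sqrt; last by apply: sumr_ge0 => j _; rewrite sqr_ge0.
by rewrite (bigD1 i) //= lerDl; apply: sumr_ge0 => j _; rewrite sqr_ge0.
Qed.

Lemma normr_coordB x y i : `|x 0 i - y 0 i| <= enorm (x - y).
Proof. by have := normr_coord (x - y) i; rewrite !mxE. Qed.

Lemma enorm0_eq0 x : enorm x = 0 -> x = 0.
Proof.
move=> x0; apply/rowP => i; rewrite mxE; apply/eqP.
by rewrite -normr_le0 -x0 normr_coord.
Qed.

Lemma enormZ a x : enorm (a *: x) = `|a| * enorm x.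
Proof.
rewrite !enormE dotpZl dotpC dotpZl mulrA -expr2 sqrtrM ?sqr_ge0//.
by rewrite sqrtr_sqr.
Qed.

Lemma enormN x : enorm (- x) = enorm x.
Proof. by rewrite -scaleN1r enormZ normrN1 mul1r. Qed.

Lemma enormC x y : enorm (x - y) = enorm (y - x).
Proof. by rewrite -enormN opprB. Qed.

Lemma dotp_le x y : dotp x y <= enorm x * enorm y.
Proof.
have [x0|xp] := leP (enorm x) 0.
  have -> : x = 0 by apply: enorm0_eq0; apply/eqP; rewrite eq_le x0 enorm_ge0.
  by rewrite enorm0 mul0r /dotp big1 // => i _; rewrite mxE mul0r.
have [y0|yp] := leP (enorm y) 0.
  have -> : y = 0 by apply: enorm0_eq0; apply/eqP; rewrite eq_le y0 enorm_ge0.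
  by rewrite enorm0 mulr0 /dotp big1 // => i _; rewrite mxE mulr0.
have := dotp_ge0 (enorm y *: x + (- enorm x) *: y).
rewrite !(dotpDl, dotpDr, dotpZl, dotpZr) (dotpC y x) -!enorm_sqr.
move: (enorm x) (enorm y) xp yp (dotp x y) => a b a0 b0 t H.
have : 0 <= 2 * (a * b) * (a * b - t).
  by apply: le_trans H _; rewrite le_eqVlt; apply/orP; left; apply/eqP; ring.
by rewrite pmulr_rge0 ?subr_ge0 // !mulr_gt0.
Qed.

Lemma enormD x y : enorm (x + y) <= enorm x + enorm y.
Proof.
rewrite -(@ler_pXn2r _ 2) // ?nnegrE ?addr_ge0 ?enorm_ge0 //.
rewrite enorm_sqr dotpDl !dotpDr (dotpC y x) -!enorm_sqr.
by have := dotp_le x y; set a := enorm x; set b := enorm y => H; nra.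
Qed.

Lemma enormB x y : enorm (x - y) <= enorm x + enorm y.
Proof. by rewrite (le_trans (enormD _ _)) // enormN. Qed.

Lemma enorm_triangle z x y : enorm (x - y) <= enorm (x - z) + enorm (z - y).
Proof. by apply: le_trans (enormD _ _); rewrite addrA subrK. Qed.

Lemma enorm_sum (I : finType) (P : pred I) (F : I -> 'rV[R]_n) :
  enorm (\sum_(i | P i) F i) <= \sum_(i | P i) enorm (F i).
Proof.
elim/big_ind2: _ => [|x1 x2 y1 y2 h1 h2|//]; first by rewrite enorm0.
by apply: le_trans (enormD _ _) _; exact: lerD.
Qed.

Lemma enorm_le_coord x M : 0 <= M -> (forall i, `|x 0 i| <= M) ->
  enorm x <= n%:R * M.
Proof.
move=> M0 xM; rewrite /enorm -(@ler_pXn2r _ 2) // ?nnegrE ?sqrtr_ge0 ?mulr_ge0 //.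
rewrite sqr_sqrtr; last by apply: sumr_ge0 => i _; rewrite sqr_ge0.
apply: (@le_trans _ _ (\sum_(i < n) M ^+ 2)).
  by apply: ler_sum => i _; rewrite -(real_normK (num_real (x 0 i))) ler_pXn2r // nnegrE.
rewrite sumr_const card_ord exprMn -[M ^+ 2 *+ n]mulr_natl ler_wpM2r ?sqr_ge0 //.
rewrite -natrX ler_nat -mulnn; have [->//|n0] := posnP n.
by rewrite leq_pmulr.
Qed.

Definition lipschitz_with (k : R) (f : 'rV[R]_n -> 'rV[R]_n) :=
  forall x y, enorm (f x - f y) <= k * enorm (x - y).

End Euclid.

Lemma mxDE (R : realType) m n (A B : 'M[R]_(m, n)) i j :
  (A + B) i j = A i j + B i j.
Proof. by rewrite mxE. Qed.

Lemma mxNE (R : realType) m n (A : 'M[R]_(m, n)) i j : (- A) i j = - A i j.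
Proof. by rewrite mxE. Qed.

Lemma mxZE (R : realType) m n a (A : 'M[R]_(m, n)) i j : (a *: A) i j = a * A i j.
Proof. by rewrite mxE. Qed.

Lemma mx0E (R : realType) m n i j : (0 : 'M[R]_(m, n)) i j = 0.
Proof. by rewrite mxE. Qed.

(* Proves identities between row vectors that are affine in the products [_ *m _]. *)
Ltac mxlin :=
  rewrite ?(mulmxDl, mulmxDr, mulmxBl, mulmxBr, mulmx1, mul1mx, mulmxA,
            mulNmx, mulmxN, mul0mx, mulmx0, =^~ scalemxAl);
  let i := fresh in
  apply/rowP => i; rewrite ?(mxDE, mxNE, mxZE, mx0E); ring.

Ltac mxlin_using E :=
  rewrite ?(mulmxDl, mulmxDr, mulmxBl, mulmxBr, mulmx1, mul1mx, mulmxA,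
            mulNmx, mulmxN, mul0mx, mulmx0, =^~ scalemxAl) ?E;
  let i := fresh in
  apply/rowP => i; rewrite ?(mxDE, mxNE, mxZE, mx0E); ring.

(** * Perturbations of the identity and Lipschitz extensions *)

Section Limits.
Context {R : realType}.

(** Stands in for limit arguments: two points are shown to agree by bounding their distance by a
    multiple of q^k for every k. *)
Lemma le0_geometric (t C q : R) : 0 <= q -> q < 1 ->
  (forall k, t <= C * q ^+ k) -> t <= 0.
Proof.
move=> q0 q1 tC.
have q1' : `|q| < 1 by rewrite ger0_norm.
have cq := cvg_geometric C q1'.
rewrite -(cvg_lim (@Rhausdorff R) cq).
by apply: limr_ge; [apply: cvgP cq | apply: nearW => k; exact: tC].
Qed.

Lemma powR_exprn (a b : R) k : 0 <= a -> (a ^+ k) `^ b = (a `^ b) ^+ k.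
Proof.
move=> a0; rewrite -(powR_mulrn k a0) -(powR_mulrn k (powR_ge0 a b)).
by rewrite -2!powRrM (mulrC b).
Qed.

Lemma geometric_scale (del : R) : 0 < del -> del <= 1 ->
  exists k, 10^-1 ^+ k.+1 < del /\ del <= 10^-1 ^+ k.
Proof.
have t0 : 0 < 10^-1 :> R by lra.
move=> d0 d1; have : exists k, 10^-1 ^+ k.+1 < del.
  apply: contrapT => /forallNP h; suff : del <= 0 by lra.
  apply: (@le0_geometric del 1 10^-1); [exact: ltW|by lra|] => -[|k].
    by rewrite expr0 mul1r.
  by rewrite mul1r leNgt; apply/negP/h.
move=> /ex_minnP[k hk kmin]; exists k; split=> //.
case: k hk kmin => [|k] hk kmin; first by rewrite expr0.
by rewrite leNgt; apply/negP => /kmin; rewrite ltnn.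
Qed.

Lemma geometric_cauchy (a : nat -> R) (M q : R) : 0 <= M -> 0 <= q -> q < 1 ->
  (forall k, `|a k.+1 - a k| <= M * q ^+ k) ->
  exists l, forall k, `|a k - l| <= M * q ^+ k / (1 - q).
Proof.
move=> M0 q0 q1 aM.
(* [b k] is the tail of the geometric series, so the intervals [a k - b k, a k + b k] are nested and
   the supremum of their left ends lies in all of them. *)
pose b k := M * q ^+ k / (1 - q).
have bS k : b k.+1 = b k - M * q ^+ k.
  by rewrite /b exprS; field; rewrite subr_eq0 gt_eqF.
have b0 k : 0 <= b k.
  by rewrite /b divr_ge0 ?subr_ge0 ?(ltW q1)// mulr_ge0 // exprn_ge0.
have lo_mono i j : a i - b i <= a (i + j)%N - b (i + j)%N.
  elim: j => [|j IH]; first by rewrite addn0.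
  rewrite addnS bS; apply: le_trans IH _.
  by have := aM (i + j)%N; rewrite ler_norml => /andP[h _]; lra.
have hi_mono i j : a (i + j)%N + b (i + j)%N <= a i + b i.
  elim: j => [|j IH]; first by rewrite addn0.
  rewrite addnS bS; apply: le_trans IH.
  by have := aM (i + j)%N; rewrite ler_norml => /andP[_ h]; lra.
have lohi i j : a i - b i <= a j + b j.
  have := lo_mono i j; have := hi_mono j i; rewrite addnC.
  by have := b0 (i + j)%N; lra.
exists (sup (range (fun k => a k - b k))) => k.
have H1 : a k - b k <= sup (range (fun k => a k - b k)).
  apply: ub_le_sup; last by exists k.
  by exists (a 0%N + b 0%N) => _ [i _ <-].
have H2 : sup (range (fun k => a k - b k)) <= a k + b k.
  apply: ge_sup; first by exists (a 0%N - b 0%N); exists 0%N.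
  by move=> _ [i _ <-].
by rewrite ler_norml -/(b k); apply/andP; split; lra.
Qed.

Lemma geometric_cauchy_rv n (a : nat -> 'rV[R]_n) (M q : R) :
  0 <= M -> 0 <= q -> q < 1 ->
  (forall k, enorm (a k.+1 - a k) <= M * q ^+ k) ->
  exists l, forall k, enorm (a k - l) <= n%:R * (M * q ^+ k / (1 - q)).
Proof.
move=> M0 q0 q1 aM.
have /choice[l hl] : forall i : 'I_n, exists l, forall k,
    `|a k 0 i - l| <= M * q ^+ k / (1 - q).
  move=> i; apply: geometric_cauchy => // k.
  by apply: le_trans (aM k); exact: normr_coordB.
exists (\row_i l i) => k; apply: enorm_le_coord.
  by rewrite divr_ge0 ?subr_ge0 ?(ltW q1)// mulr_ge0 // exprn_ge0.
by move=> i; rewrite !mxE hl.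
Qed.

Lemma lipschitz_perturbation_inj n (D : 'rV[R]_n -> 'rV[R]_n) (k : R) x y :
  lipschitz_with k D ->
  (1 - k) * enorm (x - y) <= enorm (x + D x - (y + D y)).
Proof.
move=> /(_ x y) Dk.
have := enormB (x + D x - (y + D y)) (D x - D y).
have -> : x + D x - (y + D y) - (D x - D y) = x - y by mxlin.
lra.
Qed.

(** Picard iteration for [x |-> y - D x], whose successive differences shrink by 1/2. *)
Lemma lipschitz_perturbation_surj n (D : 'rV[R]_n -> 'rV[R]_n) (k : R) y :
  k <= 2^-1 -> lipschitz_with k D -> exists x, x + D x = y.
Proof.
move=> k2 Dk.
have [a [a0 aS]] : exists a : nat -> 'rV[R]_n,
    a 0%N = 0 /\ forall m, a m.+1 = y - D (a m).
  by exists (fun m => iter m (fun x => y - D x) 0).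
have DkE u v : enorm (D u - D v) <= 2^-1 * enorm (u - v).
  by apply: le_trans (Dk u v) _; rewrite ler_wpM2r ?enorm_ge0.
have aM m : enorm (a m.+1 - a m) <= enorm (a 1%N) * 2^-1 ^+ m.
  elim: m => [|m IH]; first by rewrite expr0 mulr1 a0 subr0.
  have -> : a m.+2 - a m.+1 = - (D (a m.+1) - D (a m)).
    by rewrite (aS m.+1) {2}(aS m); mxlin.
  rewrite enormN (le_trans (DkE _ _)) // exprS mulrCA.
  by rewrite ler_wpM2l ?invr_ge0.
have [||| x xl] := geometric_cauchy_rv _ _ _ aM; rewrite ?enorm_ge0 ?invr_ge0 //.
  by lra.
exists x; apply/eqP; rewrite -subr_eq0; apply/eqP; apply: enorm0_eq0.
apply/eqP; rewrite eq_le enorm_ge0 andbT.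
apply: (@le0_geometric _ (2 * n%:R * enorm (a 1%N)) 2^-1); [lra|lra|] => m.
have -> : x + D x - y = - (a m.+1 - x) - (D (a m) - D x).
  by rewrite (aS m); mxlin.
apply: le_trans (enormB _ _) _; rewrite enormN.
have h1 := xl m.+1; have h2 := le_trans (DkE (a m) x) (ler_wpM2l _ (xl m)).
have {}h2 := h2 ltac:(lra).
apply: le_trans (lerD h1 h2) _.
rewrite exprS le_eqVlt; apply/orP; left; apply/eqP; field; lra.
Qed.

End Limits.

Section McShane.
Context {R : realType} {n : nat}.

Lemma mcshane_real (X : set 'rV[R]_n) (f : 'rV[R]_n -> R) (L : R) : 0 <= L ->
  (forall x y, X x -> X y -> `|f x - f y| <= L * enorm (x - y)) ->
  exists F : 'rV[R]_n -> R,
    (forall x, X x -> F x = f x) /\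
    (forall x y, `|F x - F y| <= L * enorm (x - y)).
Proof.
move=> L0 fL; have [X0|/set0P[x0 Xx0]] := eqVneq X set0.
  exists (fun _ => 0); split=> [x|x y]; first by rewrite X0.
  by rewrite subrr normr0 mulr_ge0 ?enorm_ge0.
(* McShane's formula: the infimum of the cones of slope [L] standing on the graph of [f]. *)
pose S y := [set f x + L * enorm (x - y) | x in X].
have S0 y : S y !=set0 by exists (f x0 + L * enorm (x0 - y)); exists x0.
have Slb y : has_lbound (S y).
  exists (f x0 - L * enorm (y - x0)) => _ [x Xx <-].
  have := fL _ _ Xx Xx0; rewrite ler_norml => /andP[h _].
  have := ler_wpM2l L0 (enorm_triangle y x x0); rewrite mulrDr; lra.
exists (fun y => inf (S y)); split.
  move=> x Xx; apply/eqP; rewrite eq_le; apply/andP; split.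
    apply: ge_inf => //; exists x => //.
    by rewrite subrr enorm0 mulr0 addr0.
  apply: lb_le_inf => // _ [y Xy <-].
  by have := fL _ _ Xx Xy; rewrite ler_norml enormC => /andP[_ h]; lra.
have half x y : inf (S x) - inf (S y) <= L * enorm (x - y).
  suff : inf (S x) - L * enorm (x - y) <= inf (S y) by lra.
  apply: lb_le_inf => // _ [z Xz <-].
  have : inf (S x) <= f z + L * enorm (z - x) by apply: ge_inf => //; exists z.
  have := ler_wpM2l L0 (enorm_triangle y z x); rewrite mulrDr (enormC y x); lra.
move=> x y; rewrite ler_norml half andbT.
by have := half y x; rewrite enormC; lra.
Qed.

Lemma mcshane (X : set 'rV[R]_n) (f : 'rV[R]_n -> 'rV[R]_n) (L : R) : 0 <= L ->
  (forall x y, X x -> X y -> enorm (f x - f y) <= L * enorm (x - y)) ->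
  exists F : 'rV[R]_n -> 'rV[R]_n,
    (forall x, X x -> F x = f x) /\ lipschitz_with (n%:R * L) F.
Proof.
move=> L0 fL.
have /choice[F hF] : forall i : 'I_n, exists F : 'rV[R]_n -> R,
    (forall x, X x -> F x = f x 0 i) /\
    (forall x y, `|F x - F y| <= L * enorm (x - y)).
  move=> i; apply: mcshane_real => // x y Xx Xy.
  by apply: le_trans (fL _ _ Xx Xy); exact: normr_coordB.
exists (fun x => \row_i F i x); split.
  by move=> x Xx; apply/rowP => i; rewrite mxE; apply: (hF i).1.
move=> x y; rewrite -mulrA; apply: enorm_le_coord.
  by rewrite mulr_ge0 ?enorm_ge0.
by move=> i; rewrite !mxE; exact: (hF i).2.
Qed.

Definition clamp (M t : R) := Num.max (- M) (Num.min M t).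

Lemma clamp_lip (M s t : R) : `|clamp M s - clamp M t| <= `|s - t|.
Proof.
have h1 := ler_norm (s - t); have := ler_norm (t - s); rewrite distrC => h2.
rewrite /clamp !minEle !maxEle.
by do !case: ifPn; rewrite -?ltNge => *; rewrite ler_norml; apply/andP; split; lra.
Qed.

(** Clamping a coordinate to [-M, M] is 1-Lipschitz and leaves the values on [X] alone, so the bound
    known on [X] carries over to the whole space. The maps id + D_k need it there: their
    compositions are to converge at every point. *)
Lemma mcshane_bounded (X : set 'rV[R]_n) (f : 'rV[R]_n -> 'rV[R]_n) (L M : R) :
  0 <= L -> 0 <= M ->
  (forall x y, X x -> X y -> enorm (f x - f y) <= L * enorm (x - y)) ->
  (forall x, X x -> enorm (f x) <= M) ->
  exists F : 'rV[R]_n -> 'rV[R]_n,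
    [/\ forall x, X x -> F x = f x, lipschitz_with (n%:R * L) F &
        forall x, enorm (F x) <= n%:R * M].
Proof.
move=> L0 M0 fL fM; have /choice[F hF] : forall i : 'I_n, exists F : 'rV[R]_n -> R,
    (forall x, X x -> F x = f x 0 i) /\
    (forall x y, `|F x - F y| <= L * enorm (x - y)).
  move=> i; apply: mcshane_real => // x y Xx Xy.
  by apply: le_trans (fL _ _ Xx Xy); exact: normr_coordB.
exists (fun x => \row_i clamp M (F i x)); split.
- move=> x Xx; apply/rowP => i; rewrite mxE (hF i).1 // /clamp.
  have := le_trans (normr_coord (f x) i) (fM _ Xx).
  by rewrite ler_norml => /andP[h1 h2]; rewrite min_r // max_r.
- move=> x y; rewrite -mulrA; apply: enorm_le_coord.
    by rewrite mulr_ge0 ?enorm_ge0.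
  by move=> i; rewrite !mxE; apply: le_trans (clamp_lip _ _ _) ((hF i).2 x y).
- move=> x; apply: enorm_le_coord => // i.
  by rewrite mxE ler_norml /clamp le_max lexx ge_max ge_min lexx /= andbT; lra.
Qed.

End McShane.

(** * Orthogonal projections and affine planes *)

Section Projections.
Context {R : realType} {n : nat}.
Implicit Types (x y z u v : 'rV[R]_n) (p q A B : 'M[R]_n).

(** Symmetric idempotent matrices acting on rows from the right. With planes encoded this way, the
    offset of [x] from a plane is [x *m (1%:M - p)] and the angle of two planes is the operator norm
    of a difference. *)
Definition isproj p := p^T = p /\ p *m p = p.

Definition opnorm_le A (c : R) := forall x, enorm (x *m A) <= c * enorm x.

Lemma mulmx_projK p : isproj p -> forall m (A : 'M[R]_(m, n)), A *m p *m p = A *m p.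
Proof. by move=> [_ pp] m A; rewrite -mulmxA pp. Qed.

Lemma isproj_compl p : isproj p -> isproj (1%:M - p).
Proof.
move=> [pT pp]; split; first by rewrite raddfB /= trmx1 pT.
by rewrite mulmxBl mul1mx mulmxBr mulmx1 pp subrr subr0.
Qed.

Lemma proj_le p x : isproj p -> enorm (x *m p) <= enorm x.
Proof.
move=> [pT pp]; have [->|/eqP x0] := eqVneq (enorm (x *m p)) 0.
  exact: enorm_ge0.
have xp : 0 < enorm (x *m p).
  by rewrite lt_neqAle enorm_ge0 eq_sym andbT; apply/eqP.
rewrite -(ler_pM2r xp) -expr2 enorm_sqr dotp_mulmx pT -mulmxA pp.
exact: dotp_le.
Qed.

Lemma projC_le p x : isproj p -> enorm (x *m (1%:M - p)) <= enorm x.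
Proof. by move=> /isproj_compl /proj_le. Qed.

Lemma opnorm_tr A (c : R) : opnorm_le A c -> opnorm_le A^T c.
Proof.
move=> Ac x; have [->|/eqP x0] := eqVneq (enorm (x *m A^T)) 0.
  have := le_trans (enorm_ge0 _) (Ac x).
  by [].
have xp : 0 < enorm (x *m A^T).
  by rewrite lt_neqAle enorm_ge0 eq_sym andbT; apply/eqP.
rewrite -(ler_pM2r xp) -expr2 enorm_sqr dotp_mulmx trmxK.
apply: le_trans (dotp_le _ _) _; rewrite mulrC mulrAC ler_wpM2r ?enorm_ge0 //.
Qed.

Lemma opnormD A B (a b : R) : opnorm_le A a -> opnorm_le B b -> opnorm_le (A + B) (a + b).
Proof.
move=> Aa Bb x; rewrite mulmxDr mulrDl.
by apply: le_trans (enormD _ _) (lerD (Aa x) (Bb x)).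
Qed.

Lemma opnormN A (a : R) : opnorm_le A a -> opnorm_le (- A) a.
Proof. by move=> Aa x; rewrite mulmxN enormN. Qed.

Lemma opnorm_triangle B A C (a b : R) :
  opnorm_le (A - B) a -> opnorm_le (B - C) b -> opnorm_le (A - C) (a + b).
Proof. by move=> h1 h2; have := opnormD h1 h2; rewrite addrA subrK. Qed.

Lemma opnormC A B (a : R) : opnorm_le (A - B) a -> opnorm_le (B - A) a.
Proof. by move=> /opnormN; rewrite opprB. Qed.

(** The identity p - q = p (1 - q) - (q (1 - p))^T splits the difference into the amounts by which
    each plane leaves the other, which are what a Hausdorff distance controls. *)
Lemma proj_diff_le p q (a b : R) : isproj p -> isproj q ->
  opnorm_le (p *m (1%:M - q)) a -> opnorm_le (q *m (1%:M - p)) b ->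
  opnorm_le (p - q) (a + b).
Proof.
move=> [pT pp] [qT qq] Ha /opnorm_tr Hb.
have -> : p - q = p *m (1%:M - q) + - (q *m (1%:M - p))^T.
  have pCT : (1%:M - p)^T = 1%:M - p by rewrite raddfB /= trmx1 pT.
  rewrite trmx_mul pCT qT mulmxBr mulmxBl mulmx1 mul1mx.
  by rewrite opprB addrA subrK.
by apply: opnormD => //; exact: opnormN.
Qed.

(** With a basis as the rows of [U], the projection is U^T (U U^T)^-1 U. The Gram matrix is
    invertible because c U U^T = 0 forces |c U|^2 = 0. *)
Lemma vspace_proj (V : {vspace 'rV[R]_n}) :
  exists p, isproj p /\ forall v, (v \in V) <-> exists u, v = u *m p.
Proof.
pose b := vbasis V.
pose U : 'M[R]_(\dim V, n) := \matrix_i tnth b i.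
have VU v : (v \in V) <-> exists c : 'rV[R]_(\dim V), v = c *m U.
  split=> [vV|[c ->]].
    exists (\row_i coord b i v); rewrite {1}(coord_vbasis vV) mulmx_sum_row.
    by refine (eq_bigr _ _) => i _; rewrite mxE rowK (tnth_nth 0).
  rewrite mulmx_sum_row; apply: memv_suml => i _; rewrite rowK memvZ //.
  by apply: vbasis_mem; exact: mem_tnth.
have Ufree (c : 'rV[R]_(\dim V)) : c *m U = 0 -> c = 0.
  rewrite mulmx_sum_row => h.
  have /freeP bf := basis_free (vbasisP V).
  apply/rowP => i; rewrite mxE; apply: (bf (fun i => c 0 i)).
  by refine (etrans _ h); refine (eq_bigr _ _) => j _; rewrite rowK (tnth_nth 0).
have G : U *m U^T \in unitmx.
  rewrite -row_free_unit; apply/row_freeP.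
  have /row_freeP : row_free (U *m U^T); last by [].
  rewrite -kermx_eq0; apply/eqP/row_matrixP => i; rewrite row0.
  set c := row i _; have : c *m (U *m U^T) = 0.
    by rewrite /c -row_mul mulmx_ker row0.
  move=> cG; apply: Ufree; apply: enorm0_eq0.
  apply/eqP; rewrite -sqrf_eq0 enorm_sqr dotpE trmx_mul mulmxA -(mulmxA c) cG.
  by rewrite mul0mx mxE.
exists (U^T *m invmx (U *m U^T) *m U); split; first split.
- by rewrite !trmx_mul trmxK trmx_inv trmx_mul trmxK mulmxA.
- by rewrite -!mulmxA (mulmxA U U^T) (mulmxA (invmx _) (U *m U^T)) mulVmx // mul1mx.
- move=> v; rewrite VU; split=> [[c ->]|[u ->]].
    exists (c *m U); rewrite -!mulmxA (mulmxA U U^T) (mulmxA (U *m U^T)).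
    by rewrite mulmxV // mul1mx.
  by exists (u *m U^T *m invmx (U *m U^T)); rewrite !mulmxA.
Qed.

Definition plane z p : set 'rV[R]_n := [set z + v *m p | v in setT].

(* [p] is the orthogonal projection onto a linear [d]-plane *)
Definition projd (d : nat) p :=
  isproj p /\ forall z, affine_plane d (plane z p).

Lemma affine_planeP d (P : set 'rV[R]_n) x : affine_plane d P -> P x ->
  exists p, projd d p /\ P = plane x p.
Proof.
move=> [a [V [dV PE]]] Px; have [p [pp Vp]] := vspace_proj V.
have planeE z : plane z p = [set z + v | v in [set v | v \in V]].
  apply/seteqP; split=> y.
    by move=> [v _ <-]; exists (v *m p) => //=; apply/Vp; exists v.
  by move=> [v /= /Vp[u ->] <-]; exists u.
exists p; split.
  by split=> // z; exists z, V; split; rewrite ?planeE.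
rewrite planeE PE; move: Px; rewrite PE => -[v0 /= v0V <-].
apply/seteqP; split=> y [v /= vV <-].
  by exists (v - v0); rewrite /= ?memvB // -addrA (addrC v0) subrK.
by exists (v0 + v); rewrite /= ?memvD // addrA.
Qed.

Lemma edist_to_plane z p y (t : R) : isproj p ->
  (edist_to y (plane z p) <= t%:E)%E -> enorm ((y - z) *m (1%:M - p)) <= t.
Proof.
move=> pp h; rewrite -lee_fin; apply: le_trans h.
apply: le_ereal_inf_tmp => _ [_ [v _ <-] <-]; rewrite lee_fin.
have -> : (y - z) *m (1%:M - p) = (y - (z + v *m p)) *m (1%:M - p).
  by mxlin_using (mulmx_projK pp).
exact: projC_le.
Qed.

Lemma edist_to_le (F : set 'rV[R]_n) y z (t : R) : F z -> enorm (y - z) <= t ->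
  (edist_to y F <= t%:E)%E.
Proof.
move=> Fz yz; apply: (@le_trans _ _ (enorm (y - z))%:E); last by rewrite lee_fin.
by apply: ge_ereal_inf; exists (enorm (y - z))%:E => //; exists z.
Qed.

Lemma local_hdist_le (E F : set 'rV[R]_n) x (r t : R) : 0 < r ->
  (forall y, E y -> enorm (y - x) <= r -> exists2 z, F z & enorm (y - z) <= t * r) ->
  (forall y, F y -> enorm (y - x) <= r -> exists2 z, E z & enorm (y - z) <= t * r) ->
  (local_hdist x r E F <= t%:E)%E.
Proof.
move=> r0 EF FE; rewrite /local_hdist lee_pdivrMl // -EFinM mulrC ge_max.
apply/andP; split; apply: ge_ereal_sup => _ [y [hy1 hy2] <-].
  by have [z Fz yz] := EF y hy1 hy2; apply: edist_to_le yz.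
by have [z Fz yz] := FE y hy1 hy2; apply: edist_to_le yz.
Qed.

Lemma local_hdistP (E F : set 'rV[R]_n) x (r t : R) : 0 < r ->
  (local_hdist x r E F <= t%:E)%E ->
  (forall y, E y -> enorm (y - x) <= r -> (edist_to y F <= (t * r)%:E)%E) /\
  (forall y, F y -> enorm (y - x) <= r -> (edist_to y E <= (t * r)%:E)%E).
Proof.
move=> r0; rewrite /local_hdist lee_pdivrMl // -EFinM mulrC ge_max.
move=> /andP[h1 h2]; split=> y hy yx.
  by apply: le_trans h1; apply: ereal_sup_ubound; exists y.
by apply: le_trans h2; apply: ereal_sup_ubound; exists y.
Qed.

(** Origin of the factor 6 in front of eps. Vectors of length r in the first plane, tested from its
    own point [x], give 2 t. The second plane has to be tested from the projection of [x] onto it,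
    which leaves only vectors of length r / 2 and gives 4 t. *)
Lemma local_hdist_plane x x' p p' (r t : R) : isproj p -> isproj p' ->
  0 < r -> t <= 2^-1 ->
  (local_hdist x r (plane x p) (plane x' p') <= t%:E)%E ->
  enorm ((x - x') *m (1%:M - p')) <= t * r /\ opnorm_le (p - p') (6 * t).
Proof.
move=> pp pp' r0 t1 /(local_hdistP r0)[h1 h2].
have inx v : plane x p (x + v *m p) by exists v.
have inx' v : plane x' p' (x' + v *m p') by exists v.
have xx : plane x p x by exists 0; rewrite ?mul0mx ?addr0.
have H0 : enorm ((x - x') *m (1%:M - p')) <= t * r.
  by apply: edist_to_plane => //; apply: h1 => //; rewrite subrr enorm0 ltW.
split=> //.
have t0 : 0 <= t.
  by have := le_trans (enorm_ge0 _) H0; rewrite pmulr_lge0.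
have scale (A : 'M[R]_n) (a s : R) : 0 < s -> 0 <= a ->
    (forall v, enorm v <= s -> enorm (v *m A) <= a * s) -> opnorm_le A a.
  move=> s0 a0 H v; have [v0|v0] := leP (enorm v) 0.
    have -> : v = 0 by apply: enorm0_eq0; apply/eqP; rewrite eq_le v0 enorm_ge0.
    by rewrite mul0mx enorm0 mulr0.
  have k0 : 0 < s / enorm v by rewrite divr_gt0.
  have := H ((s / enorm v) *: v); rewrite -scalemxAl !enormZ (gtr0_norm k0).
  have kv : s / enorm v * enorm v = s by rewrite divfK // gt_eqF.
  rewrite kv => /(_ (lexx _)) => h.
  by rewrite -(ler_pM2l k0) (le_trans h) // mulrCA kv.
have -> : 6 * t = 2 * t + 4 * t by ring.
apply: proj_diff_le => //.
  apply: (scale _ _ r) => //; first by lra.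
  move=> v vr.
  have h := h1 _ (inx v); rewrite addrC addKr in h.
  have {}h := edist_to_plane pp' (h (le_trans (proj_le _ pp) vr)).
  have -> : v *m (p *m (1%:M - p')) =
     (x + v *m p - x') *m (1%:M - p') - (x - x') *m (1%:M - p') by mxlin.
  by have := enormB ((x + v *m p - x') *m (1%:M - p')) ((x - x') *m (1%:M - p')); lra.
(* [x' + w] is the projection of [x] onto the second plane, at distance at most t r <= r / 2 from
   [x]. *)
pose w := (x - x') *m p'.
have hw (v : 'rV[R]_n) : (x' + (w + v) *m p' - x) = v *m p' - (x - x') *m (1%:M - p').
  by rewrite /w; mxlin_using (mulmx_projK pp').
have key v : enorm v <= r / 2 ->
    enorm ((x' + (w + v) *m p' - x) *m (1%:M - p)) <= t * r.
  move=> vr; apply: edist_to_plane => //; apply: h2; first exact: inx'.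
  rewrite hw; apply: le_trans (enormB _ _) _.
  by have := proj_le v pp'; nra.
apply: (scale _ _ (r / 2)); [lra|lra|] => v vr.
have -> : v *m (p' *m (1%:M - p)) = (x' + (w + v) *m p' - x) *m (1%:M - p) -
     (x' + (w + 0) *m p' - x) *m (1%:M - p) by mxlin.
have k0 : enorm (0 : 'rV[R]_n) <= r / 2 by rewrite enorm0; lra.
apply: le_trans (enormB _ _) _.
by have := key _ vr; have := key _ k0; lra.
Qed.

End Projections.

(** * Partitions of unity *)

Section PartitionOfUnity.
Context {R : realType}.

Definition ramp (m t : R) : R := Num.max 0 (Num.min t m).

Lemma ramp_sum (L : nat) (t : R) : \sum_(j < L) ramp 1 (t - j%:R) = ramp L%:R t.
Proof.
elim: L => [|L IH].
  by rewrite big_ord0 /ramp minEle maxEle; do !case: ifPn; rewrite -?ltNge => *; lra.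
rewrite big_ord_recr /= IH -natr1 /ramp; have : 0 <= L%:R :> R by [].
by rewrite !minEle !maxEle; do !case: ifPn; rewrite -?ltNge => *; lra.
Qed.

Lemma ramp1_eq0 (t : R) : t <= 0 -> ramp 1 t = 0.
Proof. by move=> t0; rewrite /ramp min_l ?max_l //; lra. Qed.

Lemma ramp1_eq1 (t : R) : 1 <= t -> ramp 1 t = 1.
Proof. by move=> t1; rewrite /ramp min_r // max_r. Qed.

Lemma ramp_mono (m s t : R) : s <= t -> ramp m s <= ramp m t.
Proof.
move=> st; rewrite /ramp !minEle !maxEle.
by do !case: ifPn; rewrite -?ltNge => *; lra.
Qed.

(** All increments have the same sign, so their absolute values add up to the increment of one long
    ramp; hence a bound independent of [L]. *)
Lemma ramp_sum_lip (L : nat) (s t : R) :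
  \sum_(j < L) `|ramp 1 (s - j%:R) - ramp 1 (t - j%:R)| <= `|s - t|.
Proof.
wlog ts : s t / t <= s.
  move=> H; have [/H//|/ltW/H] := leP t s.
  by rewrite distrC; under eq_bigr do rewrite distrC.
rewrite (eq_bigr (fun j : 'I_L => ramp 1 (s - j%:R) - ramp 1 (t - j%:R))); last first.
  by move=> j _; rewrite ger0_norm // subr_ge0 ramp_mono // lerD2r.
rewrite sumrB !ramp_sum ger0_norm ?subr_ge0 // /ramp.
have : 0 <= L%:R :> R by [].
by rewrite !minEle !maxEle; do !case: ifPn; rewrite -?ltNge => *; lra.
Qed.

Lemma interval_partition (s M : R) : 0 < s -> 0 <= M ->
  exists (L : nat) (c : 'I_L -> R) (h : 'I_L -> R -> R),
    [/\ forall j t, 0 <= h j t,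
        forall t, \sum_j h j t <= 1,
        forall t, `|t| <= M -> \sum_j h j t = 1,
        forall j t, h j t != 0 -> `|t - c j| <= s &
        forall t u, \sum_j `|h j t - h j u| <= 2 / s * `|t - u|].
Proof.
move=> s0 M0; pose N := (Num.truncn (M / s)).+2.
have MN : M / s + 1 <= N%:R.
  have := Num.Theory.truncnS_gt (M / s); rewrite /N -natr1; lra.
pose v t : R := t / s + N%:R.
(* consecutive differences of ramps are hat functions, and their sum telescopes *)
pose h (j : 'I_(N + N)) (t : R) := ramp 1 (v t - j%:R) - ramp 1 (v t - j.+1%:R).
have tel t : \sum_j h j t = ramp 1 (v t) - ramp 1 (v t - (N + N)%:R).
  rewrite (eq_bigr (fun j : 'I_(N + N) => - (ramp 1 (v t - j.+1%:R) - ramp 1 (v t - j%:R)))).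
    rewrite sumrN -(big_mkord xpredT (fun j => ramp 1 (v t - j.+1%:R) - ramp 1 (v t - j%:R))).
    by rewrite telescope_sumr // subr0 opprB.
  by move=> j _; rewrite opprB.
exists (N + N)%N, (fun j => (j%:R + 1 - N%:R) * s), h; split.
- by move=> j t; rewrite /h subr_ge0 ramp_mono // -natr1; lra.
- move=> t; rewrite tel /ramp !minEle !maxEle.
  by do !case: ifPn; rewrite -?ltNge => *; lra.
- move=> t tM; rewrite tel natrD.
  have : `|t / s| <= N%:R - 1.
    have si : 0 < s^-1 by rewrite invr_gt0.
    rewrite normrM (gtr0_norm si).
    have : `|t| / s <= M / s by rewrite ler_pM2r.
    lra.
  rewrite ler_norml /v => /andP[h1 h2].
  by rewrite ramp1_eq1 ?ramp1_eq0 ?subr0 //; lra.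
- move=> j t hj.
  have : `|v t - j%:R - 1| <= 1.
    apply/negPn/negP; rewrite -ltNge => far; move/negP: hj; apply; apply/eqP.
    rewrite /h -natr1; move: far; rewrite ltr_normr => /orP[] far.
      by rewrite !ramp1_eq1 ?subrr //; lra.
    by rewrite !ramp1_eq0 ?subrr //; lra.
  have -> : t - (j%:R + 1 - N%:R) * s = (v t - j%:R - 1) * s.
    by rewrite /v; field; rewrite gt_eqF.
  by move=> H; rewrite normrM (gtr0_norm s0) -[leRHS]mul1r ler_pM2r.
- move=> t u.
  have vE : `|v t - v u| = s^-1 * `|t - u|.
    have -> : v t - v u = s^-1 * (t - u) by rewrite /v; ring.
    by rewrite normrM gtr0_norm ?invr_gt0.
  have -> : 2 / s * `|t - u| = `|v t - v u| + `|(v t - 1) - (v u - 1)|.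
    have -> : (v t - 1) - (v u - 1) = v t - v u by ring.
    by rewrite vE; ring.
  apply: le_trans (lerD (ramp_sum_lip (N + N) _ _) (ramp_sum_lip (N + N) _ _)).
  rewrite -big_split /=; apply: ler_sum => j _; rewrite /h.
  rewrite -natr1 !opprD !addrA -!(addrAC _ (- 1)) .
  by apply: le_trans (ler_normB _ _); rewrite le_eqVlt; apply/orP; left;
    apply/eqP; congr `| _ |; ring.
Qed.

(** A bounded region suffices, so the family is finite and its sum is only required to be 1 there.
    The last clause bounds the variation of the whole family at once, which allows averages at two
    points to be compared without counting overlaps. *)
Lemma partition_of_unity n (r M : R) : (0 < n)%N -> 0 < r -> 0 <= M ->
  exists (I : finType) (c : I -> 'rV[R]_n) (th : I -> 'rV[R]_n -> R),
    [/\ forall i y, 0 <= th i y,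
        forall y, \sum_i th i y <= 1,
        forall y, enorm y <= M -> \sum_i th i y = 1,
        forall i y, th i y != 0 -> enorm (y - c i) <= r &
        forall y z, \sum_i `|th i y - th i z| <= 2 * n%:R ^+ 2 / r * enorm (y - z)].
Proof.
move=> n0 r0 M0.
have n0' : 0 < n%:R :> R by rewrite ltr0n.
(* An error [s] in each of the n coordinates gives at most n s = r in Euclidean norm, and the n
   Lipschitz constants 2 / s add up to 2 n^2 / r. *)
pose s := r / n%:R; have s0 : 0 < s by rewrite divr_gt0.
have [L [cc [h [h_ge0 h_le1 h_eq1 h_supp h_lip]]]] := interval_partition s0 M0.
(* tensor products of one-dimensional partitions, one coordinate at a time *)
have tensor k : (k <= n)%N -> exists (I : finType) (c : I -> 'rV[R]_n)
    (th : I -> 'rV[R]_n -> R),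
    [/\ forall i y, 0 <= th i y,
        forall y, \sum_i th i y <= 1,
        forall y, enorm y <= M -> \sum_i th i y = 1,
        forall i y, th i y != 0 -> forall l : 'I_n, (l < k)%N -> `|y 0 l - c i 0 l| <= s &
        forall y z, \sum_i `|th i y - th i z| <= k%:R * (2 / s) * enorm (y - z)].
  elim: k => [_|k IH kn].
    exists unit, (fun _ => 0), (fun _ _ => 1); split => //.
    - by move=> y; rewrite big_const card_unit /= addr0.
    - by move=> y; rewrite big_const card_unit /= addr0.
    - by move=> y z; rewrite big1 ?mul0r // => _ _; rewrite subrr normr0.
  have [I [c [th [t1 t2 t3 t4 t5]]]] := IH (ltnW kn).
  pose k' := Ordinal kn.
  exists (I * 'I_L)%type,
    (fun p => \row_l if l == k' then cc p.2 else c p.1 0 l),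
    (fun p y => th p.1 y * h p.2 (y 0 k')).
  have sumE y : \sum_(p : I * 'I_L) th p.1 y * h p.2 (y 0 k') =
      (\sum_i th i y) * (\sum_j h j (y 0 k')).
    rewrite -(pair_bigA _ (fun i j => th i y * h j (y 0 k'))) /=.
    by rewrite mulr_suml; apply: eq_bigr => i _; rewrite mulr_sumr.
  have th_ge0 y : 0 <= \sum_i th i y by apply: sumr_ge0.
  have hs_ge0 t : 0 <= \sum_j h j t by apply: sumr_ge0.
  split.
  - by move=> p y; rewrite mulr_ge0.
  - by move=> y; rewrite sumE mulr_ile1.
  - move=> y yM; rewrite sumE t3 // mul1r h_eq1 //.
    exact: le_trans (normr_coord _ _) yM.
  - move=> p y; rewrite mulf_eq0 negb_or => /andP[/t4 h1 /h_supp h2] l lk.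
    rewrite mxE; case: eqP => [->//|/eqP lk']; apply: h1.
    by rewrite ltn_neqAle -ltnS lk andbT.
  - move=> y z.
    apply: (@le_trans _ _ (\sum_(p : I * 'I_L)
       (th p.1 y * `|h p.2 (y 0 k') - h p.2 (z 0 k')| + `|th p.1 y - th p.1 z| * h p.2 (z 0 k')))).
      apply: ler_sum => p _.
      have -> : th p.1 y * h p.2 (y 0 k') - th p.1 z * h p.2 (z 0 k') =
        th p.1 y * (h p.2 (y 0 k') - h p.2 (z 0 k')) + (th p.1 y - th p.1 z) * h p.2 (z 0 k').
        by ring.
      apply: le_trans (ler_normD _ _) _.
      by rewrite !normrM (ger0_norm (t1 _ _)) (ger0_norm (h_ge0 _ _)).
    rewrite big_split /=.
    rewrite -(pair_bigA _ (fun i j => th i y * `|h j (y 0 k') - h j (z 0 k')|)) /=.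
    rewrite -(pair_bigA _ (fun i j => `|th i y - th i z| * h j (z 0 k'))) /=.
    under eq_bigr do rewrite -mulr_sumr.
    under [X in _ + X <= _]eq_bigr do rewrite -mulr_sumr.
    rewrite -!mulr_suml.
    have H1 : \sum_j `|h j (y 0 k') - h j (z 0 k')| <= 2 / s * enorm (y - z).
      apply: le_trans (h_lip _ _) _; apply: ler_wpM2l; first by rewrite divr_ge0 // ltW.
      exact: normr_coordB.
    have H1' : 0 <= \sum_j `|h j (y 0 k') - h j (z 0 k')| by apply: sumr_ge0.
    have H2' : 0 <= \sum_i `|th i y - th i z| by apply: sumr_ge0.
    rewrite -natr1 mulrDl mulrDl mul1r addrC; apply: lerD.
      by apply: le_trans (t5 y z); rewrite ler_piMr.
    by apply: le_trans H1; rewrite ler_piMl.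
have [I [c [th [t1 t2 t3 t4 t5]]]] := tensor n (leqnn n).
exists I, c, th; split => //.
- move=> i y /t4 hi; apply: (@le_trans _ _ (n%:R * s)).
    by apply: enorm_le_coord => [|l]; [exact: ltW|rewrite !mxE hi].
  by rewrite /s mulrC divfK // gt_eqF.
- move=> y z; apply: le_trans (t5 y z) _.
  by rewrite le_eqVlt; apply/orP; left; apply/eqP; rewrite /s; field; rewrite !gt_eqF.
Qed.

End PartitionOfUnity.

(** * Lipschitz graphs *)

Section LipschitzGraphs.
Context {R : realType} {n : nat}.
Implicit Types (x y z u v c : 'rV[R]_n) (p q : 'M[R]_n) (S : set 'rV[R]_n).

(* In the ball B(c, rho), [S] is the image of the linear plane [im p] under a
   perturbation of the identity with Lipschitz constant [lam]. *)
Definition lgraph S c (rho : R) p (lam : R) :=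
  exists psi : 'rV[R]_n -> 'rV[R]_n, lipschitz_with lam psi /\
    forall y, enorm (y - c) <= rho ->
      (S y <-> exists v, y = v *m p + psi (v *m p)).

Lemma lgraph_sub S c c' (rho rho' : R) p (lam lam' : R) :
  enorm (c' - c) + rho' <= rho -> lam <= lam' ->
  lgraph S c rho p lam -> lgraph S c' rho' p lam'.
Proof.
move=> cc ll [psi [psiL psiS]]; exists psi; split.
  by move=> x y; apply: le_trans (psiL x y) _; rewrite ler_wpM2r ?enorm_ge0.
move=> y yc; apply: psiS.
by have := enorm_triangle c' y c; lra.
Qed.

Lemma lgraph_eq S S' c (rho : R) p (lam : R) :
  (forall y, enorm (y - c) <= rho -> (S y <-> S' y)) ->
  lgraph S c rho p lam -> lgraph S' c rho p lam.
Proof.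
move=> SS [psi [psiL psiS]]; exists psi; split=> // y yc.
by rewrite -SS // psiS.
Qed.

Lemma lgraph_cone S c (rho : R) p (lam : R) y z : isproj p -> 0 <= lam -> lam <= 2^-1 ->
  lgraph S c rho p lam -> S y -> S z ->
  enorm (y - c) <= rho -> enorm (z - c) <= rho ->
  enorm ((y - z) *m (1%:M - p)) <= 2 * lam * enorm (y - z).
Proof.
move=> pp lam0 lam2 [psi [psiL psiS]] Sy Sz yc zc.
have [v yE] := (psiS _ yc).1 Sy; have [w zE] := (psiS _ zc).1 Sz.
have h := lipschitz_perturbation_inj (v *m p) (w *m p) psiL.
rewrite -yE -zE in h.
have -> : (y - z) *m (1%:M - p) = (psi (v *m p) - psi (w *m p)) *m (1%:M - p).
  by rewrite yE zE; mxlin_using (mulmx_projK pp).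
apply: le_trans (projC_le _ pp) _; apply: le_trans (psiL _ _) _.
have := enorm_ge0 (v *m p - w *m p).
have : enorm (v *m p - w *m p) <= 2 * enorm (y - z).
  by have := enorm_ge0 (v *m p - w *m p); nra.
move: (enorm (v *m p - w *m p)) (enorm (y - z)) => a b ab a0.
by rewrite (mulrC 2) -mulrA ler_wpM2l.
Qed.

(** The new function is [psi u + D (u + psi u)]. Its values are in general not normal to the plane,
    which is why [lgraph] leaves the direction of [psi] free. The factor 2 bounds 1 + lam. *)
Lemma lgraph_image S D c (rho rho' : R) p (lam mu del : R) :
  0 <= mu -> lam <= 1 -> rho' + del <= rho ->
  lipschitz_with mu D -> (forall x, enorm (D x) <= del) ->
  lgraph S c rho p lam ->
  lgraph [set x + D x | x in S] c rho' p (lam + 2 * mu).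
Proof.
move=> mu0 lam1 rr DL Dd [psi [psiL psiS]].
exists (fun u => psi u + D (u + psi u)); split.
  move=> x y.
  have h1 := psiL x y; have h2 := DL (x + psi x) (y + psi y).
  have h3 := enormD (psi x - psi y) (D (x + psi x) - D (y + psi y)).
  have h4 : enorm (x + psi x - (y + psi y)) <= 2 * enorm (x - y).
    have -> : x + psi x - (y + psi y) = (x - y) + (psi x - psi y) by mxlin.
    by apply: le_trans (enormD _ _) _; have := enorm_ge0 (x - y); nra.
  have -> : psi x + D (x + psi x) - (psi y + D (y + psi y)) =
    (psi x - psi y) + (D (x + psi x) - D (y + psi y)) by mxlin.
  have := ler_wpM2l mu0 h4; lra.
have near z y : y = z + D z -> enorm (y - c) <= rho' -> enorm (z - c) <= rho.
  move=> -> zc; have -> : z - c = (z + D z - c) - D z by mxlin.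
  by apply: le_trans (enormB _ _) _; have := Dd z; lra.
move=> y yc; split=> [[z Sz yE]|[v yE]].
  have [v zE] := (psiS _ (near z y (esym yE) yc)).1 Sz.
  by exists v; rewrite -yE {1 2}zE addrA -zE.
pose z := v *m p + psi (v *m p).
have yE' : y = z + D z by rewrite yE addrA.
by exists z => //; apply/(psiS _ (near z y yE' yc)); exists v.
Qed.

(** Finds a point of [S] straight above the centre, by solving [w + psi (w *m p) *m p = c]. For such
    a point a bound on the normal offset from [c] is a bound on the whole distance. *)
Lemma lgraph_over S c (rho : R) p (lam : R) z0 : isproj p -> 0 <= lam -> lam <= 2^-1 ->
  lgraph S c rho p lam -> S z0 -> 4 * enorm (z0 - c) <= rho ->
  exists2 z, S z & (z - c) *m p = 0 /\ enorm (z - c) <= 4 * enorm (z0 - c).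
Proof.
move=> pp lam0 lam2 [psi [psiL psiS]] Sz0 z0c.
have z0c' : enorm (z0 - c) <= rho by have := enorm_ge0 (z0 - c); lra.
have [v0 z0E] := (psiS _ z0c').1 Sz0.
have DL : lipschitz_with lam (fun z => psi (z *m p) *m p).
  move=> x y; rewrite -mulmxBl; apply: le_trans (proj_le _ pp) _.
  apply: le_trans (psiL _ _) _; rewrite ler_wpM2l // -mulmxBl.
  exact: proj_le.
have [w wE] := lipschitz_perturbation_surj c lam2 DL.
pose z := w *m p + psi (w *m p).
have zpE : z *m p = c *m p by rewrite -wE /z; mxlin_using (mulmx_projK pp).
have h1 := lipschitz_perturbation_inj (w *m p) (v0 *m p) DL.
have h2 := proj_le (c - z0) pp.
have E : w *m p + psi (w *m p *m p) *m p - (v0 *m p + psi (v0 *m p *m p) *m p) =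
    (c - z0) *m p.
  by rewrite mulmxBl -zpE /z z0E; mxlin_using (mulmx_projK pp).
rewrite E in h1.
have h3 := psiL (w *m p) (v0 *m p).
have h4 : enorm (z - z0) <= 3 * enorm (z0 - c).
  have -> : z - z0 = (w *m p - v0 *m p) + (psi (w *m p) - psi (v0 *m p)).
    by rewrite /z z0E; mxlin.
  apply: le_trans (enormD _ _) _; rewrite -(enormC c z0).
  by have := enorm_ge0 (w *m p - v0 *m p); nra.
have h5 : enorm (z - c) <= 4 * enorm (z0 - c).
  by have := enorm_triangle z0 z c; lra.
have zc : enorm (z - c) <= rho by lra.
exists z; first by apply/(psiS _ zc); exists w.
by split=> //; rewrite mulmxBl zpE subrr.
Qed.

Lemma lgraph_cover S c (rho : R) p (lam : R) z v : isproj p ->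
  0 <= lam -> lam <= 2^-1 ->
  lgraph S c rho p lam -> S z -> enorm (z - c) + 2 * enorm (v *m p) <= rho ->
  exists2 y, S y & enorm (z + v *m p - y) <= lam * enorm (v *m p).
Proof.
move=> pp lam0 lam2 [psi [psiL psiS]] Sz zc.
have vp0 := enorm_ge0 (v *m p).
have zc' : enorm (z - c) <= rho by lra.
have [w zE] := (psiS _ zc').1 Sz.
have h := psiL (w *m p) ((w + v) *m p).
have E : w *m p - (w + v) *m p = - (v *m p) by mxlin.
rewrite E enormN in h.
pose y := (w + v) *m p + psi ((w + v) *m p).
have yE : z + v *m p - y = psi (w *m p) - psi ((w + v) *m p).
  by rewrite /y zE; mxlin.
exists y; last by rewrite yE.
apply/psiS; last by exists (w + v).
have -> : y - c = (z - c) + v *m p - (z + v *m p - y) by mxlin.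
have := enormB (z - c + v *m p) (z + v *m p - y).
have := enormD (z - c) (v *m p); rewrite yE; nra.
Qed.

(* Changing the reference plane; the Lipschitz constant is reset to the one
   given by the cone condition. *)
Lemma lgraph_change_plane S c (rho : R) p q (lam mu : R) y0 :
  isproj p -> isproj q -> 0 <= lam -> lam <= 100^-1 -> opnorm_le (p - q) 100^-1 ->
  0 <= mu -> n%:R * (2 * mu) <= 10^-1 ->
  lgraph S c rho p lam -> S y0 -> 10 * enorm (y0 - c) <= rho ->
  (forall y z, S y -> S z -> enorm (y - c) <= rho -> enorm (z - c) <= rho ->
    enorm ((y - z) *m (1%:M - q)) <= mu * enorm (y - z)) ->
  lgraph S c (rho / 2) q (n%:R * (2 * mu)).
Proof.
move=> pp qq lam0 lam1 pq mu0 nmu [psi [psiL psiS]] Sy0 y0c cone.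
pose A u := u + psi u.
have AL u v : enorm (A u - A v) <= (101 / 100) * enorm (u - v).
  have -> : A u - A v = (u - v) + (psi u - psi v) by rewrite /A; mxlin.
  apply: le_trans (enormD _ _) _.
  by have := psiL u v; have := enorm_ge0 (u - v); nra.
(* On im p, [A] followed by [q] differs from the identity by 1/100 from p - q and 1/100 from [psi];
   50/49 is the inverse of 1 - 1/50. *)
have key u v : enorm (u *m p - v *m p) <= 50 / 49 * enorm ((A (u *m p) - A (v *m p)) *m q).
  have -> : (A (u *m p) - A (v *m p)) *m q = (u *m p - v *m p) -
      ((u *m p - v *m p) *m (p - q) - (psi (u *m p) - psi (v *m p)) *m q).
    by rewrite /A; mxlin_using (mulmx_projK pp).
  have h1 := pq (u *m p - v *m p).
  have h2 := le_trans (proj_le (psi (u *m p) - psi (v *m p)) qq) (psiL _ _).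
  have h3 := enormB ((u *m p - v *m p) *m (p - q)) ((psi (u *m p) - psi (v *m p)) *m q).
  move: h3; set b := (X in enorm X <= _) => h3.
  have h4 := enormD (u *m p - v *m p - b) b; rewrite subrK in h4.
  by have := enorm_ge0 (u *m p - v *m p); nra.
have Akey u v : enorm (A (u *m p) - A (v *m p)) <=
    104 / 100 * enorm ((A (u *m p) - A (v *m p)) *m q).
  have := AL (u *m p) (v *m p); have := key u v.
  by have := enorm_ge0 ((A (u *m p) - A (v *m p)) *m q); lra.
have Ainj u v : A (u *m p) *m q = A (v *m p) *m q -> u *m p = v *m p.
  move=> E; apply/eqP; rewrite -subr_eq0; apply/eqP/enorm0_eq0/eqP.
  rewrite eq_le enorm_ge0 andbT; apply: le_trans (key u v) _.
  by rewrite mulmxBl E subrr enorm0 mulr0.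
have SA v : enorm (A (v *m p) - c) <= rho -> S (A (v *m p)).
  by move=> h; apply/psiS => //; exists v.
(* The shadow on im q of the part of [S] in the ball; [phi] is the height over it. It is well
   defined by [Ainj], and the cone condition makes it Lipschitz. *)
pose X := [set s | exists v, s = A (v *m p) *m q /\ enorm (A (v *m p) - c) <= rho].
have /choice[phi hphi] : forall s, exists f, X s -> exists v,
    [/\ s = A (v *m p) *m q, enorm (A (v *m p) - c) <= rho & f = A (v *m p) - s].
  move=> s; have [[v [h1 h2]]|nX] := pselect (X s); last by exists 0.
  by exists (A (v *m p) - s) => _; exists v.
have phiE v : enorm (A (v *m p) - c) <= rho ->
    phi (A (v *m p) *m q) = A (v *m p) - A (v *m p) *m q.
  move=> h; have [|w [h1 h2 ->]] := hphi (A (v *m p) *m q); first by exists v.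
  by rewrite (Ainj _ _ h1).
have phiL s t : X s -> X t -> enorm (phi s - phi t) <= 2 * mu * enorm (s - t).
  move=> [v [-> vc]] [w [-> wc]]; rewrite !phiE //.
  have -> : A (v *m p) - A (v *m p) *m q - (A (w *m p) - A (w *m p) *m q) =
    (A (v *m p) - A (w *m p)) *m (1%:M - q) by mxlin.
  apply: le_trans (cone _ _ (SA _ vc) (SA _ wc) vc wc) _.
  rewrite -mulmxBl; have := Akey v w.
  by have := enorm_ge0 ((A (v *m p) - A (w *m p)) *m q); nra.
have mu2 : 0 <= 2 * mu by lra.
have [psi' [psiE' psiL']] := mcshane mu2 phiL.
have y0c' : enorm (y0 - c) <= rho by have := enorm_ge0 (y0 - c); lra.
have rho0 : 0 <= rho by have := enorm_ge0 (y0 - c); lra.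
exists psi'; split=> // y yc; split=> [Sy|[w yE]].
  have yc' : enorm (y - c) <= rho by lra.
  have [v vE] := (psiS _ yc').1 Sy.
  exists (A (v *m p)); rewrite psiE'; last by exists v; rewrite /A -vE.
  by rewrite phiE /A -?vE // addrC subrK.
(* [z |-> A (z p) q + z (1 - p)] is a small perturbation of the identity, hence
   onto; this yields a point of [S] above every point of [im q]. *)
have DL : lipschitz_with (50^-1) (fun z => z *m p *m (q - p) + psi (z *m p) *m q).
  move=> x z; have -> : x *m p *m (q - p) + psi (x *m p) *m q -
     (z *m p *m (q - p) + psi (z *m p) *m q) = 
     - ((x *m p - z *m p) *m (p - q)) + (psi (x *m p) - psi (z *m p)) *m q by mxlin.
  apply: le_trans (enormD _ _) _; rewrite enormN.
  have h1 := pq (x *m p - z *m p).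
  have h2 := le_trans (proj_le (psi (x *m p) - psi (z *m p)) qq) (psiL _ _).
  have h3 : enorm (x *m p - z *m p) <= enorm (x - z) by rewrite -mulmxBl proj_le.
  by have := enorm_ge0 (x *m p - z *m p); nra.
have k2 : 50^-1 <= 2^-1 :> R by lra.
have [z zE] := lipschitz_perturbation_surj (w *m q) k2 DL.
pose d := z *m (1%:M - p).
have zE' : d + A (z *m p) *m q = w *m q.
  by rewrite -zE /d /A; mxlin_using (mulmx_projK pp).
(* [d] lies in im q and in the kernel of [p], so |d| = |d (p - q)| <= |d| / 100. *)
have d0 : d = 0.
  apply: enorm0_eq0; have dq : d = d *m q.
    by rewrite -(addrK (A (z *m p) *m q) d) zE'; mxlin_using (mulmx_projK qq).
  have dE : d = - (d *m (p - q)).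
    have -> : d *m (p - q) = d *m p - d *m q by mxlin.
    by rewrite -dq /d; mxlin_using (mulmx_projK pp).
  have := pq d; rewrite {1}(_ : enorm (d *m (p - q)) = enorm d); last by rewrite {2}dE enormN.
  by have := enorm_ge0 d; lra.
rewrite d0 add0r in zE'.
have [v0 v0E] := (psiS _ y0c').1 Sy0.
have y0A : y0 = A (v0 *m p) by [].
have psi0 : psi' (A (v0 *m p) *m q) = A (v0 *m p) - A (v0 *m p) *m q.
  by rewrite psiE' ?phiE -?y0A //; exists v0; rewrite -y0A.
have h1 := lipschitz_perturbation_inj (w *m q) (A (v0 *m p) *m q) psiL'.
rewrite -yE psi0 addrC (addrC (A (v0 *m p) *m q)) subrK -y0A in h1.
have h2 := Akey z v0; rewrite mulmxBl zE' -y0A in h2.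
have h3 := enorm_triangle c y y0; rewrite (enormC c) in h3.
have h4 := enorm_triangle y0 (A (z *m p)) c.
(* Room left by halving the radius: |y - y0| <= 6/10 rho gives at most 2/3 rho between the shadows,
   hence less than 7/10 rho between the points of the graph, and [y0] is within rho / 10 of [c]. *)
have zc : enorm (A (z *m p) - c) <= rho.
  by have := enorm_ge0 (w *m q - y0 *m q); nra.
rewrite yE psiE'; last by exists z.
by rewrite -zE' phiE // addrC subrK; exact: SA.
Qed.

End LipschitzGraphs.

(** * Averaged projections *)

Section Smoothing.
Context {R : realType} {n : nat}.
Implicit Types (x y z u v : 'rV[R]_n) (q : 'M[R]_n) (E S : set 'rV[R]_n).

Lemma enorm_wsum_le (I : finType) (P : pred I) (w : I -> R) (F : I -> 'rV[R]_n)
    (W M : R) : 0 <= M -> (forall i, P i -> w i != 0 -> enorm (F i) <= M) ->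
  \sum_i `|w i| <= W -> enorm (\sum_(i | P i) w i *: F i) <= W * M.
Proof.
move=> M0 FM wW; apply: le_trans (enorm_sum _ _) _.
apply: (@le_trans _ _ (\sum_(i | P i) `|w i| * M)).
  apply: ler_sum => i Pi; rewrite enormZ.
  have [->|wi] := eqVneq (w i) 0; first by rewrite normr0 !mul0r.
  by rewrite ler_wpM2l // FM.
rewrite -mulr_suml; apply: ler_wpM2r => //; apply: le_trans wW.
by rewrite [leRHS](bigID P) /= lerDl sumr_ge0.
Qed.

(** What the hypotheses on the planes give at the scale r = 10^-k: [100 * r] is 10^(-k+2), and 6
    comes from [local_hdist_plane]. *)
Definition coherent (d : nat) E (eps r : R) (p : 'rV[R]_n -> 'M[R]_n) :=
  (forall x, E x -> projd d (p x)) /\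
  forall x y, E x -> E y -> enorm (x - y) <= 100 * r ->
    enorm ((y - x) *m (1%:M - p x)) <= 100 * eps * r /\
    opnorm_le (p x - p y) (6 * eps).

(** The part of the induction invariant that concerns E. [lgraph] fixes only the slope of [S]; the
    second clause fixes its height relative to the plane through [x], and the third keeps [S] from
    missing the ball. *)
Definition graph_near E S (lam r : R) (p : 'rV[R]_n -> 'M[R]_n) :=
  forall x, E x ->
    [/\ lgraph S x (10 * r) (p x) lam,
        forall y, S y -> enorm (y - x) <= 10 * r ->
          enorm ((y - x) *m (1%:M - p x)) <= lam * r &
        exists2 z, S z & enorm (z - x) <= r].

(** The size of [D] is measured by [lam], but the last clause by [eps] alone: [z + D z] is an
    average of points of the planes at nearby points of E, and these planes are eps-close to each
    other whatever [lam] is. The plane [q] is meant to be the one of the next scale. *)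
Lemma smoothing_map d E S (p : 'rV[R]_n -> 'M[R]_n) (eps lam r : R) : (0 < n)%N ->
  0 <= eps -> 0 < r -> r <= 1 -> 0 <= lam -> lam <= 2^-1 ->
  (forall x, E x -> enorm x <= 1) -> coherent d E eps r p ->
  graph_near E S lam r p ->
  let K : R := 2 * n%:R ^+ 2 in
  exists D : 'rV[R]_n -> 'rV[R]_n,
  [/\ lipschitz_with (n%:R * ((2 + K) * lam)) D,
      forall x, enorm (D x) <= n%:R * (lam * r),
      forall y, S y -> (forall x, E x -> 5 * r < enorm (y - x)) -> D y = 0 &
      forall x q, E x -> isproj q -> opnorm_le (p x - q) (6 * eps) ->
        (forall z, S z -> enorm (z - x) <= 21 / 10 * r ->
           enorm ((z + D z - x) *m (1%:M - q)) <= 260 * eps * r) /\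
        (forall y z, S y -> S z -> enorm (y - x) <= 21 / 10 * r ->
           enorm (z - x) <= 21 / 10 * r ->
           enorm ((y + D y - (z + D z)) *m (1%:M - q)) <=
             (12 + 260 * K) * eps * enorm (y - z))].
Proof.
move=> n0 eps0 r0 r1 lam0 lam2 E1 [pE coh] gr K.
(* The weights must sum to 1 within 21/10 r of E, hence within 1 + 21/10 of the origin. *)
have M0 : 0 <= 4 :> R by lra.
have [I [c [th [th_ge0 th_le1 th_eq1 th_supp th_lip]]]] := partition_of_unity n0 r0 M0.
(* The radius 4 r catches every piece whose support meets the ball of radius 21/10 r about a point
   of E, and [D] still vanishes on [S] beyond distance 5 r from E. *)
pose act i := `[< exists x, E x /\ enorm (x - c i) <= 4 * r >].
have /choice[X hX] : forall i, exists x, act i -> E x /\ enorm (x - c i) <= 4 * r.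
  move=> i; have [/asboolP[x hx]|_] := boolP (act i); last by exists 0.
  by exists x.
have lamr0 : 0 <= lam * r by rewrite mulr_ge0 // ltW.
have thX i y : act i -> th i y != 0 -> enorm (y - X i) <= 5 * r.
  move=> /hX[_ h1] /th_supp h2; have := enorm_triangle (c i) y (X i).
  by rewrite (enormC (c i)); lra.
have norm_th y : \sum_i `|th i y| <= 1.
  by under eq_bigr do rewrite ger0_norm //.
pose F i y := (y - X i) *m (1%:M - p (X i)).
pose D0 y := - \sum_(i | act i) th i y *: F i y.
have FS i y : act i -> S y -> enorm (y - X i) <= 10 * r -> enorm (F i y) <= lam * r.
  by move=> ai Sy yX; have [_ + _] := gr _ (hX _ ai).1; exact.
have D0b y : S y -> enorm (D0 y) <= lam * r.
  move=> Sy; rewrite enormN -[leRHS]mul1r; apply: enorm_wsum_le => // i ai thi.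
  by apply: FS => //; have := thX _ _ ai thi; lra.
have D0L y z : S y -> S z -> enorm (D0 y - D0 z) <= (2 + K) * lam * enorm (y - z).
  move=> Sy Sz; have K0 : 0 <= K by rewrite mulr_ge0 // sqr_ge0.
  have yz0 := enorm_ge0 (y - z).
  (* At distance at least r the sup bound is enough; below it, [y] and [z] lie in a common graph
     ball and the product rule applies. *)
  have [far|near] := leP r (enorm (y - z)).
    apply: le_trans (enormB _ _) _; have := D0b _ Sy; have := D0b _ Sz.
    have := ler_wpM2l lam0 far.
    by have : 0 <= K * lam * enorm (y - z); [rewrite !mulr_ge0|lra].
  have -> : D0 y - D0 z = - \sum_(i | act i) th i y *: ((y - z) *m (1%:M - p (X i)))
      - \sum_(i | act i) (th i y - th i z) *: F i z.
    rewrite /D0 -!opprD -sumrB -big_split /=; congr (- _).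
    by apply: eq_bigr => i _; rewrite /F; mxlin.
  apply: le_trans (enormB _ _) _; rewrite enormN.
  have -> : (2 + K) * lam * enorm (y - z) = 1 * (2 * lam * enorm (y - z)) +
    K / r * enorm (y - z) * (lam * r) by field; rewrite gt_eqF.
  apply: lerD; apply: enorm_wsum_le => //; first by rewrite !mulr_ge0.
  - move=> i ai thi; have [h _ _] := gr _ (hX _ ai).1.
    have yX := thX _ _ ai thi.
    apply: lgraph_cone h _ _ _ _ => //; first exact: (pE _ (hX _ ai).1).1.
      by lra.
    by have := enorm_triangle y z (X i); rewrite (enormC z y); lra.
  - move=> i ai thi; apply: FS => //.
    have [thy|thy] := eqVneq (th i y) 0; last first.
      have := enorm_triangle y z (X i); rewrite (enormC z y).
      by have := thX _ _ ai thy; lra.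
    have : th i z != 0 by apply: contraNneq thi => ->; rewrite thy subrr.
    by move=> /(thX _ _ ai); lra.
have L0 : 0 <= (2 + K) * lam.
  by rewrite mulr_ge0 // addr_ge0 // mulr_ge0 // sqr_ge0.
have [D [DE DL Db]] := mcshane_bounded L0 lamr0 D0L D0b.
exists D; split => //.
  move=> y Sy far; rewrite DE // /D0 big1 ?oppr0 // => i ai.
  have [->|thi] := eqVneq (th i y) 0; first by rewrite scale0r.
  by have := far _ (hX _ ai).1; rewrite ltNge (thX _ _ ai thi).
move=> x q Ex qq pq.
have close i z : th i z != 0 -> enorm (z - x) <= 21 / 10 * r ->
    act i /\ enorm (X i - x) <= 72 / 10 * r.
  move=> thi zx; have ci := th_supp _ _ thi.
  have ai : act i.
    apply/asboolP; exists x; split=> //.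
    by have := enorm_triangle z x (c i); rewrite (enormC x z); lra.
  split=> //; have := enorm_triangle z (X i) x; rewrite (enormC (X i) z).
  by have := thX _ _ ai thi; lra.
(* [x + G i z] is the projection of [z] onto the plane through [X i]. *)
pose G i z := z - x - F i z.
have XcX i : act i -> enorm (X i - x) <= 72 / 10 * r -> opnorm_le (p (X i) - q) (12 * eps).
  move=> /hX[EX _] Xx; have -> : 12 * eps = 6 * eps + 6 * eps by ring.
  apply: opnorm_triangle pq; have [|_ //] := coh _ _ EX Ex.
  by lra.
have pGE i z : act i -> (z - X i) *m p (X i) *m (1%:M - q) =
    (z - X i) *m p (X i) *m (p (X i) - q).
  move=> ai; have [pp _] := pE _ (hX _ ai).1; mxlin_using (mulmx_projK pp).
(* 260 rounds up 100 + 6 * 7.2 + 12 * 9.3, one term for each summand of the decomposition below. *)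
have Gb i z : act i -> enorm (X i - x) <= 72 / 10 * r -> enorm (z - x) <= 21 / 10 * r ->
    enorm (G i z *m (1%:M - q)) <= 260 * eps * r.
  move=> ai Xx zx.
  have -> : G i z *m (1%:M - q) = (X i - x) *m (1%:M - p x) + (X i - x) *m (p x - q)
      + (z - X i) *m p (X i) *m (1%:M - q) by rewrite /G /F; mxlin.
  have [EX _] := hX _ ai; rewrite pGE //.
  have [|h1 _] := coh _ _ Ex EX; first by rewrite enormC; lra.
  have h2 := pq (X i - x).
  have h3 := XcX _ ai Xx ((z - X i) *m p (X i)).
  have h4 : enorm ((z - X i) *m p (X i)) <= 93 / 10 * r.
    apply: le_trans (proj_le _ (pE _ EX).1) _.
    by have := enorm_triangle x z (X i); rewrite (enormC x); lra.
  apply: le_trans (enormD _ _) _; have := enormD ((X i - x) *m (1%:M - p x)) ((X i - x) *m (p x - q)).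
  have := ler_wpM2l eps0 h4; have := ler_wpM2l eps0 Xx.
  by have : 0 <= eps * r; [rewrite mulr_ge0 // ltW|lra].
have sum1 z : enorm (z - x) <= 21 / 10 * r -> \sum_(i | act i) th i z = 1.
  move=> zx; rewrite -(th_eq1 z).
    rewrite [RHS](bigID act) /= [X in _ + X]big1 ?addr0 // => i nai.
    by apply: contraNeq nai => thi; have [] := close _ _ thi zx.
  have := enormD (z - x) x; rewrite subrK; have := E1 _ Ex; lra.
have epsr0 : 0 <= 260 * eps * r by have := mulr_ge0 eps0 (ltW r0); lra.
have resE z : S z -> enorm (z - x) <= 21 / 10 * r ->
    z + D z - x = \sum_(i | act i) th i z *: G i z.
  move=> Sz zx; rewrite DE // /D0 /G.
  under [RHS]eq_bigr do rewrite scalerBr.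
  by rewrite sumrB -scaler_suml sum1 // scale1r addrAC.
split.
  move=> z Sz zx; rewrite resE // mulmx_suml.
  under eq_bigr do rewrite -scalemxAl.
  rewrite -[leRHS]mul1r; apply: enorm_wsum_le => // i ai thi.
  by apply: Gb => //; have [] := close _ _ thi zx.
move=> y z Sy Sz yx zx.
have -> : y + D y - (z + D z) = y + D y - x - (z + D z - x) by mxlin.
rewrite !resE //.
have -> : (\sum_(i | act i) th i y *: G i y - \sum_(i | act i) th i z *: G i z) *m (1%:M - q) =
    \sum_(i | act i) th i y *: ((y - z) *m p (X i) *m (1%:M - q)) +
    \sum_(i | act i) (th i y - th i z) *: (G i z *m (1%:M - q)).
  rewrite -sumrB mulmx_suml -big_split /=; apply: eq_bigr => i _.
  by rewrite /G /F !scalemxAl -mulmxDl; congr (_ *m _); mxlin.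
apply: le_trans (enormD _ _) _.
have -> : (12 + 260 * K) * eps * enorm (y - z) = 1 * (12 * eps * enorm (y - z)) +
    K / r * enorm (y - z) * (260 * eps * r) by field; rewrite gt_eqF.
apply: lerD; apply: enorm_wsum_le => //; first by rewrite !mulr_ge0 ?enorm_ge0.
- move=> i ai thi; have [_ Xx] := close _ _ thi yx.
  have [pp _] := pE _ (hX _ ai).1.
  have -> : (y - z) *m p (X i) *m (1%:M - q) = (y - z) *m p (X i) *m (p (X i) - q).
    by mxlin_using (mulmx_projK pp).
  apply: le_trans (XcX _ ai Xx _) _; rewrite ler_wpM2l ?mulr_ge0 //.
  exact: proj_le.
- move=> i ai thi; apply: Gb => //.
  have [thy|thy] := eqVneq (th i y) 0; last by have [] := close _ _ thy yx.
  have thz : th i z != 0 by apply: contraNneq thi => ->; rewrite thy subrr.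
  by have [] := close _ _ thz zx.
Qed.

End Smoothing.

(** * From one scale to the next *)

Section InductionStep.
Context {R : realType} {n : nat}.
Implicit Types (x y z u v : 'rV[R]_n) (q : 'M[R]_n) (E S : set 'rV[R]_n).

(* Lipschitz constant, in units of 1 / r, of the partition of unity at scale r *)
Definition overlap_cst : R := 2 * n%:R ^+ 2.
(* The two summands come from the bounds [260] and [12 + 260 K] of [smoothing_map]:
   the factor 10 is the passage from [r] to [r / 10], and the factor [4 n] is lost
   when [lgraph_change_plane] extends a Lipschitz function. *)
Definition graph_cst : R := 10 * 260 + n%:R * (48 + 4 * 260 * overlap_cst).
Definition disp_cst : R := n%:R * ((2 + overlap_cst) * graph_cst).
(** The second term is the loss in one use of [lgraph_image], for a displacement with Lipschitz
    constant [disp_cst * eps]. *)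
Definition flat_cst : R := graph_cst + 2 * disp_cst.

Lemma overlap_cst_ge0 : 0 <= overlap_cst.
Proof. by rewrite mulr_ge0 // sqr_ge0. Qed.

Lemma graph_cst_ge : 10 * 260 <= graph_cst.
Proof.
have K0 := overlap_cst_ge0.
have : 0 <= n%:R * (48 + 4 * 260 * overlap_cst) by apply: mulr_ge0; [exact: ler0n|lra].
by rewrite /graph_cst; lra.
Qed.

Lemma disp_cst_ge : (0 < n)%N -> 2 * graph_cst <= disp_cst.
Proof.
move=> n0; have K0 := overlap_cst_ge0; have c0 := graph_cst_ge.
have n1 : 1 <= n%:R :> R by rewrite ler1n.
rewrite /disp_cst; apply: (@le_trans _ _ ((2 + overlap_cst) * graph_cst)); first by nra.
by rewrite ler_peMl // mulr_ge0; lra.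
Qed.

(** The part of the invariant that concerns all points of [S], including those away from E, where
    the plane [q] is inherited from an earlier scale. The radius 3 r leaves room for [lgraph_cover],
    which asks for 2 r. *)
Definition flat_everywhere (d : nat) S (r lam : R) :=
  forall z, S z -> exists2 q, projd d q & lgraph S z (3 * r) q lam.

Lemma induction_step d E S (p p' : 'rV[R]_n -> 'M[R]_n) (eps r : R) : (0 < n)%N ->
  0 <= eps -> flat_cst * eps <= (100^-1 / 10) -> 0 < r -> r <= 1 ->
  (forall x, E x -> enorm x <= 1) -> coherent d E eps r p ->
  (forall x, E x -> projd d (p' x) /\ opnorm_le (p x - p' x) (6 * eps)) ->
  graph_near E S (graph_cst * eps) r p ->
  flat_everywhere d S r (flat_cst * eps) ->
  exists D : 'rV[R]_n -> 'rV[R]_n,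
    [/\ lipschitz_with (disp_cst * eps) D,
        forall x, enorm (D x) <= disp_cst * eps * r,
        graph_near E [set x + D x | x in S] (graph_cst * eps) (r / 10) p' &
        flat_everywhere d [set x + D x | x in S] (r / 10) (flat_cst * eps)].
Proof.
move=> n0 eps0 small r0 r1 E1 coh pp' gr flat.
have K0 := overlap_cst_ge0; have c26 := graph_cst_ge; have bc := disp_cst_ge n0.
set lam := graph_cst * eps in gr *; set mu := disp_cst * eps.
have ceps : 10 * 260 * eps <= lam by rewrite ler_wpM2r.
have lamE : flat_cst * eps = lam + 2 * mu by rewrite /flat_cst mulrDl -mulrA.
have lammu : 2 * lam <= mu by rewrite /lam mulrA ler_wpM2r.
have lam0 : 0 <= lam by lra.
have mu0 : 0 <= mu by lra.
rewrite lamE in small flat *.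
have lam2 : lam <= 2^-1 by lra.
have lam3 : lam <= 100^-1 / 10 by lra.
have lam4 : lam + 2 * mu <= 100^-1 by lra.
have lam5 : 0 <= lam + 2 * mu by lra.
have lam6 : lam <= 10^-1 by lra.
have eps6 : 6 * eps <= 100^-1 by lra.
have [D [DL Db Dfar Dreset]] := smoothing_map n0 eps0 r0 r1 lam0 lam2 E1 coh gr.
have {}DL : lipschitz_with mu D.
  move=> x y; apply: le_trans (DL x y) _; rewrite le_eqVlt; apply/orP; left.
  by apply/eqP; rewrite /mu /lam /disp_cst /overlap_cst; ring.
have {}Db x : enorm (D x) <= mu * r.
  apply: le_trans (Db x) _; rewrite mulrA ler_wpM2r ?(ltW r0) //.
  rewrite /mu /disp_cst -!mulrA ler_wpM2l // -/lam ler_peMl //; lra.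
have mur : mu * r <= (100^-1 / 10) * r by rewrite ler_wpM2r; lra.
have murr : mu * r <= r / 10 by lra.
have lamr : lam * r <= (100^-1 / 10) * r := ler_wpM2r (ltW r0) lam3.
have epsr : 260 * eps * r <= lam * (r / 10) by have := ler_wpM2r (ltW r0) ceps; lra.
clear small ceps lammu c26 bc.
have pproj x : E x -> isproj (p x) by move=> Ex; have [] := coh.1 _ Ex.
pose S' := [set x + D x | x in S]; rewrite -/S'.
have img x (rho' : R) : E x -> rho' + mu * r <= 10 * r -> lgraph S' x rho' (p x) (lam + 2 * mu).
  move=> Ex hr; have [h _ _] := gr _ Ex.
  by apply: lgraph_image hr DL Db h => //; lra.
have pre x z : enorm (z + D z - x) <= 2 * r -> enorm (z - x) <= 21 / 10 * r.
  have -> : z - x = (z + D z - x) - D z by mxlin.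
  by move=> h; apply: le_trans (enormB _ _) _; have := Db z; lra.
(* The point above [x] is within lam r of it by the height bound, so that moving it by [D] leaves it
   within r / 10: closeness to E improves to the next scale. *)
have seed x : E x -> exists2 y0, S' y0 & enorm (y0 - x) <= r / 10.
  move=> Ex; have [hL ha [z0 Sz0 z0x]] := gr _ Ex.
  have z0r : 4 * enorm (z0 - x) <= 10 * r by lra.
  have [z Sz [zp zx]] := lgraph_over (pproj _ Ex) lam0 lam2 hL Sz0 z0r.
  exists (z + D z); first by exists z.
  have zE : z - x = (z - x) *m (1%:M - p x) by rewrite mulmxBr mulmx1 zp subr0.
  have := ha _ Sz (le_trans zx z0r); rewrite -zE => h1.
  have -> : z + D z - x = (z - x) + D z by mxlin.
  apply: le_trans (enormD _ _) _.
  by have := Db z; lra.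
exists D; split => //.
- move=> x Ex; have [[pp'x _] pp'd] := pp' _ Ex.
  have [Ra Rb] := Dreset _ _ Ex pp'x pp'd.
  split; last by have [y0 ? ?] := seed _ Ex; exists y0.
  + have [y0 Sy0 y0x] := seed _ Ex.
    (* The leading 2 passes from |y - z| to the distance of the images; then n (2 m) is the second
       summand of [graph_cst], times eps. *)
    pose m := 2 * ((12 + 260 * overlap_cst) * eps).
    have c0 : 0 <= (12 + 260 * overlap_cst) * eps by apply: mulr_ge0; [lra|exact: eps0].
    have m0 : 0 <= m by apply: mulr_ge0; [exact: ler0n|exact: c0].
    have nm : n%:R * (2 * m) <= lam.
      rewrite /lam /graph_cst [leRHS]mulrDl /m.
      have -> : n%:R * (2 * (2 * ((12 + 260 * overlap_cst) * eps))) =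
        n%:R * (48 + 4 * 260 * overlap_cst) * eps by ring.
      by rewrite lerDr; apply: mulr_ge0; [lra|exact: eps0].
    (* Radius 2 r, halved by the change of plane, is the 10 * (r / 10) required at the next
       scale. *)
    have h2 : 2 * r + mu * r <= 10 * r by lra.
    have hL := img _ _ Ex h2.
    have : lgraph S' x (2 * r / 2) (p' x) (n%:R * (2 * m)).
      apply: (lgraph_change_plane (pproj _ Ex) pp'x lam5 lam4 _ m0 (le_trans nm lam6) hL Sy0).
        by move=> v; apply: le_trans (pp'd v) (ler_wpM2r (enorm_ge0 _) eps6).
        by move: y0x; move: (enorm _) => a; lra.
      move=> _ _ [y Sy <-] [z Sz <-] yx zx.
      apply: le_trans (Rb _ _ Sy Sz (pre _ _ yx) (pre _ _ zx)) _.
      have yz2 : enorm (y - z) <= 2 * enorm (y + D y - (z + D z)).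
        have := lipschitz_perturbation_inj y z DL.
        by have := enorm_ge0 (y - z); nra.
      apply: le_trans (ler_wpM2l c0 yz2) _.
      by rewrite /m mulrCA mulrA.
    by apply: lgraph_sub => //; rewrite subrr enorm0; lra.
  + move=> _ [y Sy <-] yx.
    have h : enorm (y + D y - x) <= 2 * r by lra.
    exact: le_trans (Ra _ Sy (pre _ _ h)) epsr.
(* Within 7 r of E the old graph, of radius 10 r, covers a neighbourhood of [z]. Beyond it, whatever
   lands within r / 2 of [z] came from farther than 5 r from E and did not move. *)
- move=> z S'z; have [[x [Ex zx]]|far] := pselect (exists x, E x /\ enorm (z - x) <= 7 * r).
    exists (p x); first exact: coh.1.
    have h9 : 9 * r + mu * r <= 10 * r by lra.
    by apply: lgraph_sub (img _ _ Ex h9); lra.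
  have still y : S y -> enorm (y + D y - z) <= r / 2 -> D y = 0.
    move=> Sy yz; apply: Dfar => // x Ex; rewrite ltNge; apply/negP => yx.
    apply: far; exists x; split=> //.
    have -> : z - x = (y - x) + D y - (y + D y - z) by mxlin.
    apply: le_trans (enormB _ _) _; have := enormD (y - x) (D y); have := Db y; lra.
  have Sz : S z.
    case: S'z => y Sy yz; rewrite -yz still ?addr0 // yz subrr enorm0; lra.
  have [q qd ql] := flat _ Sz; exists q => //.
  have : lgraph S z (3 * (r / 10)) q (lam + 2 * mu).
    by apply: lgraph_sub ql; rewrite ?subrr ?enorm0; lra.
  apply: lgraph_eq => y yz; split=> [Sy|[u Su uy]].
    exists y => //; rewrite still ?addr0 //.
    have -> : y + D y - z = (y - z) + D y by mxlin.
    by apply: le_trans (enormD _ _) _; have := Db y; lra.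
  by rewrite -uy still ?addr0 // uy; lra.
Qed.

(** All of E is within 1 of the origin, so each plane of scale 1 is compared with [p0] through the
    one at the origin, at a cost of 6 eps twice. *)
Lemma induction_base d E (p : 'rV[R]_n -> 'M[R]_n) (p0 : 'M[R]_n) (eps : R) : (0 < n)%N ->
  0 <= eps -> flat_cst * eps <= (100^-1 / 10) ->
  (forall x, E x -> enorm x <= 1) -> E 0 -> coherent d E eps 1 p ->
  projd d p0 -> opnorm_le (p 0 - p0) (6 * eps) ->
  graph_near E (plane 0 p0) (graph_cst * eps) 1 p /\
  flat_everywhere d (plane 0 p0) 1 (flat_cst * eps).
Proof.
move=> n0 eps0 small E1 E0 coh p0d p0p.
have K0 := overlap_cst_ge0; have c26 := graph_cst_ge; have bc := disp_cst_ge n0.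
have ceps : 10 * 260 * eps <= graph_cst * eps by rewrite ler_wpM2r.
have n1 : 1 <= n%:R :> R by rewrite ler1n.
have neps : n%:R * (48 * eps) <= graph_cst * eps.
  rewrite /graph_cst mulrA ler_wpM2r //.
  have : n%:R * 48 <= n%:R * (48 + 4 * 260 * overlap_cst) by rewrite ler_wpM2l //; lra.
  lra.
have small' : graph_cst * eps <= (100^-1 / 10).
  by apply: le_trans small; rewrite ler_wpM2r // /flat_cst; lra.
have base c rho : lgraph (plane 0 p0) c rho p0 0.
  exists (fun=> 0); split=> [x y|y _]; first by rewrite subrr enorm0 mul0r.
  by split=> [[v _ <-]|[v ->]]; exists v; rewrite // add0r addr0.
have pd x : E x -> opnorm_le (p x - p0) (12 * eps).
  move=> Ex; have -> : 12 * eps = 6 * eps + 6 * eps by ring.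
  apply: opnorm_triangle p0p; have [|_ //] := coh.2 _ _ Ex E0.
  by rewrite subr0; have := E1 _ Ex; lra.
have S0 : plane 0 p0 0 by exists 0; rewrite // mul0mx addr0.
have Sfix y : plane 0 p0 y -> y *m p0 = y.
  by move=> [v _ <-]; rewrite add0r (mulmx_projK p0d.1).
split; last first.
  move=> z _; exists p0 => //; apply: lgraph_sub (base z (3 * 1)).
    by rewrite subrr enorm0 add0r.
  by apply: mulr_ge0 => //; rewrite /flat_cst; lra.
move=> x Ex; have [pp _] := coh.1 _ Ex; split.
- have m0 : 0 <= 12 * eps by lra.
  have : lgraph (plane 0 p0) x (20 / 2) (p x) (n%:R * (2 * (12 * eps))).
    apply: (lgraph_change_plane p0d.1 pp _ _ _ m0 _ (base _ _) S0) => //; try lra.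
    + by move=> v; apply: le_trans (opnormC (pd _ Ex) v) _; rewrite ler_wpM2r ?enorm_ge0; lra.
    + by rewrite sub0r enormN; have := E1 _ Ex; lra.
    + move=> y z Sy Sz _ _.
      have -> : (y - z) *m (1%:M - p x) = - ((y - z) *m (p x - p0)).
        by mxlin_using (Sfix _ Sy, Sfix _ Sz).
      by rewrite enormN; exact: pd.
  by apply: lgraph_sub; [rewrite subrr enorm0|]; lra.
- move=> y Sy yx.
  have -> : (y - x) *m (1%:M - p x) = - (y *m (p x - p0)) + (0 - x) *m (1%:M - p x).
    by mxlin_using (Sfix _ Sy).
  apply: le_trans (enormD _ _) _; rewrite enormN.
  have x1 := E1 _ Ex.
  have [|h1 _] := coh.2 _ _ Ex E0; first by rewrite subr0; lra.
  have h2 := pd _ Ex y.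
  have : enorm y <= 11 by have := enormD (y - x) x; rewrite subrK; lra.
  by move=> /(ler_wpM2l eps0); lra.
- by exists 0 => //; rewrite sub0r enormN E1.
Qed.

End InductionStep.

(** * Infinite compositions *)

Section Assembly.
Context {R : realType} {n : nat}.
Variables (D : nat -> 'rV[R]_n -> 'rV[R]_n) (kap : R).
Hypotheses (kap0 : 0 <= kap) (kap1 : kap <= 100^-1).
Hypothesis D_lip : forall k, lipschitz_with kap (D k).
Hypothesis D_le : forall k x, enorm (D k x) <= kap * 10^-1 ^+ k.

Fixpoint compose_perturbations k (x : 'rV[R]_n) : 'rV[R]_n :=
  if k is k'.+1 then
    compose_perturbations k' x + D k' (compose_perturbations k' x)
  else x.
Local Notation G := compose_perturbations.

Local Notation t := (10^-1 : R).
Let t0 : 0 < t. Proof. by lra. Qed.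
Local Ltac slra := move: kap0 kap1; lra.

Lemma compose_upper k x y : enorm (G k x - G k y) <= (1 + kap) ^+ k * enorm (x - y).
Proof.
elim: k => [|k IH] /=; first by rewrite expr0 mul1r.
have -> : G k x + D k (G k x) - (G k y + D k (G k y)) =
  (G k x - G k y) + (D k (G k x) - D k (G k y)) by mxlin.
apply: le_trans (enormD _ _) _; rewrite exprS -mulrA.
have := D_lip k (G k x) (G k y); have k1 : 0 <= 1 + kap by slra.
have := ler_wpM2l k1 IH; move: ((1 + kap) ^+ k * _) => A; slra.
Qed.

Lemma compose_lower k x y : (1 - kap) ^+ k * enorm (x - y) <= enorm (G k x - G k y).
Proof.
elim: k => [|k IH] /=; first by rewrite expr0 mul1r.
apply: le_trans (lipschitz_perturbation_inj _ _ (D_lip k)).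
by rewrite exprS -mulrA ler_wpM2l //; slra.
Qed.

Lemma compose_surj k y : exists x, G k x = y.
Proof.
elim: k y => [|k IH] y /=; first by exists y.
have [|x <-] := lipschitz_perturbation_surj y _ (D_lip k); first by slra.
by have [z <-] := IH x; exists z.
Qed.

Lemma compose_cauchy k m x : enorm (G (k + m)%N x - G k x) <= 2 * kap * t ^+ k.
Proof.
have tk : 0 <= t ^+ k by rewrite exprn_ge0 // ltW.
(* The factor 1 - t^m of the partial geometric sum makes the induction close; 2 rounds up 1 / (1 -
   t). *)
suff : enorm (G (k + m)%N x - G k x) <= 2 * kap * t ^+ k * (1 - t ^+ m).
  have c0 : 0 <= 2 * kap * t ^+ k by rewrite !mulr_ge0.
  by move/le_trans; apply; rewrite ler_piMr // gerBl exprn_ge0 // ltW.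
elim: m => [|m IH]; first by rewrite addn0 subrr enorm0 expr0 subrr mulr0.
rewrite addnS /=.
have -> : G (k + m)%N x + D (k + m)%N (G (k + m)%N x) - G k x =
  (G (k + m)%N x - G k x) + D (k + m)%N (G (k + m)%N x) by mxlin.
apply: le_trans (enormD _ _) _; have := D_le (k + m) (G (k + m)%N x).
rewrite exprD exprS; have : 0 <= kap * (t ^+ k * t ^+ m).
  by rewrite !mulr_ge0 // exprn_ge0 // ltW.
by move: IH; move: (t ^+ k) (t ^+ m) => a b; slra.
Qed.

Lemma compose_limit : exists g : 'rV[R]_n -> 'rV[R]_n,
  forall k x, enorm (g x - G k x) <= 2 * kap * t ^+ k.
Proof.
have t1 : t < 1 by slra.
have /choice[g hg] : forall x, exists l, forall k,
    enorm (G k x - l) <= n%:R * (kap * t ^+ k / (1 - t)).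
  move=> x; apply: geometric_cauchy_rv => //.
  by move=> k /=; rewrite addrAC subrr add0r.
(* The coordinatewise limit carries a factor n; letting m grow in [compose_cauchy] removes it, as
   the numerical Hoelder constants require. *)
exists g => k x; rewrite -subr_le0.
apply: (@le0_geometric _ _ (n%:R * (kap * t ^+ k / (1 - t))) t); [exact: ltW|by []|] => m.
have h1 := hg x (k + m)%N; have h2 := compose_cauchy k m x.
have := enorm_triangle (G (k + m)%N x) (g x) (G k x); rewrite (enormC (g x) (G (k + m)%N x)).
have -> : n%:R * (kap * t ^+ k / (1 - t)) * t ^+ m = n%:R * (kap * t ^+ (k + m) / (1 - t)).
  by rewrite exprD; ring.
move: h1 h2.
move: (n%:R * (kap * t ^+ (k + m) / (1 - t))) (2 * kap * t ^+ k) => b c.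
lra.
Qed.

Variable g : 'rV[R]_n -> 'rV[R]_n.
Hypothesis gG : forall k x, enorm (g x - G k x) <= 2 * kap * t ^+ k.

Lemma dist_limit k x y :
  `|enorm (g x - g y) - enorm (G k x - G k y)| <= 4 * kap * t ^+ k.
Proof.
have h1 := gG k x; have h2 := gG k y.
have h3 := enorm_triangle (G k x) (g x) (g y).
have h4 := enorm_triangle (G k y) (G k x) (g y).
have h5 := enorm_triangle (g x) (G k x) (G k y).
have h6 := enorm_triangle (g y) (g x) (G k y).
rewrite (enormC (G k y) (g y)) in h4; rewrite (enormC (G k x) (g x)) in h5.
by rewrite ler_norml; apply/andP; split; slra.
Qed.

Lemma half_pow_le k : (1 - kap) ^+ k >= 2^-1 ^+ k.
Proof. by rewrite lerXn2r ?nnegrE //; slra. Qed.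

(** A crude bound on the inverse, sufficient wherever it meets an error of order 10^-k. *)
Lemma compose_lower_half k x y : enorm (x - y) <= 2 ^+ k * enorm (G k x - G k y).
Proof.
have h2 : 0 < 2 ^+ k :> R by rewrite exprn_gt0.
rewrite -(ler_pM2l (_ : 0 < 2^-1 ^+ k)) ?exprn_gt0 ?invr_gt0 // mulrA -exprMn.
rewrite mulVf // expr1n mul1r; apply: le_trans (compose_lower k x y).
by rewrite ler_wpM2r ?enorm_ge0 // half_pow_le.
Qed.

Lemma limit_surj y : exists x, g x = y.
Proof.
have /choice[w hw] : forall k, exists x, G k x = y by move=> k; exact: compose_surj.
(* The map [G k.+1] sends [w k] to [y + D k y] and [w k.+1] to [y]; pulling back the gap costs
   2^(k+1). *)
have wM k : enorm (w k.+1 - w k) <= 2 * kap * 5^-1 ^+ k.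
  apply: le_trans (compose_lower_half k.+1 _ _) _.
  rewrite hw /= hw enormC addrAC subrr add0r.
  have h2 : 0 <= 2 ^+ k.+1 :> R by rewrite exprn_ge0.
  apply: le_trans (ler_wpM2l h2 (D_le k y)) _.
  have -> : 5^-1 = 2 * 10^-1 :> R by slra.
  by rewrite exprMn exprS le_eqVlt; apply/orP; left; apply/eqP; ring.
have [|||x hx] := geometric_cauchy_rv _ _ _ wM; [slra|slra|slra|].
set C := n%:R * (2 * kap / (1 - 5^-1)).
have C0 : 0 <= C by rewrite mulr_ge0 // divr_ge0; slra.
exists x; apply/eqP; rewrite -subr_eq0; apply/eqP/enorm0_eq0/eqP.
rewrite eq_le enorm_ge0 andbT.
apply: (@le0_geometric _ _ (2 * kap + C) (2 / 5)); [slra|slra|] => k.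
apply: le_trans (enorm_triangle (G k x) _ _) _; rewrite mulrDl; apply: lerD.
  apply: le_trans (gG k x) _; rewrite ler_wpM2l; [by []|slra|].
  by rewrite lerXn2r ?nnegrE; slra.
rewrite -(hw k); apply: le_trans (compose_upper _ _ _) _; rewrite enormC.
apply: (@le_trans _ _ (2 ^+ k * (C * 5^-1 ^+ k))).
  apply: ler_pM; rewrite ?enorm_ge0 ?exprn_ge0 //; try slra.
    by rewrite lerXn2r ?nnegrE; slra.
  apply: le_trans (hx k) _; rewrite le_eqVlt; apply/orP; left; apply/eqP.
  by rewrite /C; ring.
by rewrite exprMn le_eqVlt; apply/orP; left; apply/eqP; ring.
Qed.

(** The preimage of [x] under [g] is pulled back to within O((2/10)^k) of im p for every k, so its
    component normal to im p vanishes. *)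
Lemma limit_mem (p : 'M[R]_n) x :
  (forall k, exists v, enorm (x - G k (v *m p)) <= t ^+ k) -> isproj p ->
  exists v, x = g (v *m p).
Proof.
move=> hx pp; have [w wx] := limit_surj x; exists w; rewrite -wx; congr g.
apply/eqP; rewrite -subr_eq0; apply/eqP/enorm0_eq0/eqP.
rewrite eq_le enorm_ge0 andbT.
apply: (@le0_geometric _ _ (2 * kap + 1) 5^-1); [slra|slra|] => k.
have [v hv] := hx k.
have -> : w - w *m p = (w - v *m p) *m (1%:M - p) by mxlin_using (mulmx_projK pp).
apply: le_trans (projC_le _ pp) _; apply: le_trans (compose_lower_half k _ _) _.
have h1 := gG k w; rewrite wx in h1.
have := enorm_triangle x (G k w) (G k (v *m p)); rewrite (enormC (G k w) x).
move=> h2; have {}h2 : enorm (G k w - G k (v *m p)) <= (2 * kap + 1) * t ^+ k by slra.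
have h3 : 0 <= 2 ^+ k :> R by rewrite exprn_ge0.
apply: le_trans (ler_wpM2l h3 h2) _; have -> : 5^-1 = 2 * t :> R by slra.
by rewrite exprMn mulrCA.
Qed.

(** * Hoelder estimates for the limit map *)

Section Hoelder.
Variable tau : R.
Hypotheses (tau0 : 0 < tau) (tau1 : tau < 1).
(** [kap_up] absorbs the growth (1 + kap)^k when |x - y| <= t^k. In [kap_low] one factor 1 - kap is
    the loss per scale; the other is there because |x - y| is only known to be at most (t / (1 -
    kap))^j. *)
Hypothesis kap_up : (1 + kap) * t `^ tau <= 1.
Hypothesis kap_low : t `^ tau <= (1 - kap) ^+ 2.

Lemma powR_le1 (a : R) : 0 <= a -> a <= 1 -> a `^ tau <= 1.
Proof.
move=> a0 a1; have -> : 1 = 1 `^ tau :> R by rewrite powR1.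
by apply: ge0_ler_powR; rewrite ?nnegrE // ltW.
Qed.

Lemma limit_upper x y : enorm (x - y) <= 1 ->
  enorm (g x - g y) <= 3 * enorm (x - y) `^ (1 - tau).
Proof.
move=> d1; have [d0|dp] := leP (enorm (x - y)) 0.
  have /enorm0_eq0/eqP : enorm (x - y) = 0 by apply/eqP; rewrite eq_le d0 enorm_ge0.
  by rewrite subr_eq0 => /eqP ->; rewrite subrr enorm0 mulr_ge0 // powR_ge0.
have [k [k1 k2]] := geometric_scale dp d1.
have := dist_limit k x y; rewrite ler_norml => /andP[_ h].
have h2 := compose_upper k x y.
set del := enorm (x - y) in d1 dp k1 k2 h2 *.
have dE : del `^ (1 - tau) * del `^ tau = del.
  by rewrite -powRD ?subrK ?powRr1 ?(ltW dp) // gt_eqF // implybT.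
have hT : (1 + kap) ^+ k * del `^ tau <= 1.
  apply: (@le_trans _ _ (((1 + kap) * t `^ tau) ^+ k)).
    rewrite exprMn -powR_exprn; last exact: ltW.
    rewrite ler_wpM2l ?exprn_ge0 //; first by slra.
    by rewrite ge0_ler_powR ?nnegrE ?exprn_ge0 // ?ltW.
  by rewrite exprn_ile1 // mulr_ge0 ?powR_ge0 //; slra.
have p0 : 0 <= del `^ (1 - tau) := powR_ge0 _ _.
have h3 : (1 + kap) ^+ k * del <= del `^ (1 - tau).
  by rewrite -{1}dE mulrCA ler_piMr.
have h4 : del <= del `^ (1 - tau).
  by rewrite -{1}dE ler_piMr // powR_le1 // ltW.
have h5 : t ^+ k <= 10 * del by rewrite exprS in k1; slra.
have := ler_wpM2l kap0 h5; have := ler_wpM2r (ltW dp) kap1; slra.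
Qed.

(** The scale is the first k at which |G k x - G k y| reaches t^k, so that the tail error is at most
    4 kap times that distance. It exists since (1 - kap)^k decays more slowly than t^k, and its
    minimality bounds |x - y| from above. *)
Lemma limit_lower x y : enorm (x - y) <= 1 ->
  4^-1 * enorm (x - y) `^ (1 + tau) <= enorm (g x - g y).
Proof.
move=> d1; have [d0|dp] := leP (enorm (x - y)) 0.
  have -> : enorm (x - y) = 0 by apply/eqP; rewrite eq_le d0 enorm_ge0.
  by rewrite powR0 ?mulr0 ?enorm_ge0 //; rewrite gt_eqF //; move: tau0; lra.
set q := 1 - kap; have q0 : 0 < q by rewrite /q; slra.
have q1 : q <= 1 by rewrite /q; slra.
have hq k := compose_lower k x y; rewrite -/q in hq.
set del := enorm (x - y) in d1 dp hq *.
have : exists k, t ^+ k <= enorm (G k x - G k y).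
  apply: contrapT => /forallNP h; suff : del <= 0 by slra.
  apply: (@le0_geometric _ _ 1 (t / q)).
  - by rewrite divr_ge0 // ltW.
  - by rewrite ltr_pdivrMr // mul1r /q; slra.
  - move=> k; rewrite mul1r expr_div_n ler_pdivlMr ?exprn_gt0 // mulrC.
    by apply: le_trans (hq k) _; apply/ltW; rewrite ltNge; apply/negP/h.
move=> /ex_minnP[k hk kmin].
have := dist_limit k x y; rewrite ler_norml => /andP[h _].
have h1 : (1 - 4 * kap) * (q ^+ k * del) <= enorm (g x - g y).
  have k4 : 0 <= 1 - 4 * kap by slra.
  have := ler_wpM2l k4 (hq k); have := ler_wpM2l kap0 hk; slra.
have dE : del `^ (1 + tau) = del `^ tau * del.
  by rewrite addrC powRD ?powRr1 ?(ltW dp) // (gt_eqF dp) implybT.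
have dT1 : del `^ tau <= 1.
  by rewrite powR_le1 // ltW.
apply: le_trans h1; rewrite dE.
suff h2 : q * del `^ tau <= q ^+ k.
  have h3 := ler_wpM2r (ltW dp) h2; rewrite -mulrA in h3.
  have : 0 <= del `^ tau * del by rewrite mulr_ge0 ?powR_ge0 // ltW.
  move: (del `^ tau * del) h3 => A h3 A0.
  have : 99 / 100 * A <= q * A by rewrite ler_wpM2r // /q; slra.
  have : 96 / 100 * (q ^+ k * del) <= (1 - 4 * kap) * (q ^+ k * del).
    have c0 : 0 <= q ^+ k * del by rewrite mulr_ge0 ?exprn_ge0 ?ltW.
    by rewrite ler_wpM2r //; slra.
  slra.
case: k hk kmin {h} => [_ _|j _ jmin].
  by rewrite expr0; have := powR_ge0 del tau; nra.
have hj : q ^+ j * del <= t ^+ j.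
  apply: le_trans (hq j) _; apply/ltW; rewrite ltNge; apply/negP => /jmin.
  by rewrite ltnn.
rewrite exprS; apply: ler_wpM2l; first exact: ltW.
have hd : del <= (t / q) ^+ j.
  by rewrite expr_div_n ler_pdivlMr ?exprn_gt0 // mulrC.
have tq0 : 0 <= t / q by rewrite divr_ge0 // ltW.
apply: (@le_trans _ _ (((t / q) ^+ j) `^ tau)).
  by apply: ge0_ler_powR; rewrite ?nnegrE ?exprn_ge0 // ltW.
rewrite powR_exprn //; apply: lerXn2r; rewrite ?nnegrE ?powR_ge0 //; first exact: ltW.
have qt : q <= q `^ tau.
  by rewrite -{1}(powRr1 (ltW q0)) ger_powR ?q0 // ltW.
have qi : q^-1 `^ tau = (q `^ tau)^-1.
  by rewrite -(powR_inv1 (ltW q0)) -powRrM mulN1r powRN.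
have qi0 : 0 <= q^-1 by rewrite invr_ge0 ltW.
rewrite (powRM _ (ltW t0) qi0) qi ler_pdivrMr ?powR_gt0 //.
by apply: le_trans kap_low _; rewrite -/q expr2 ler_wpM2l // ltW.
Qed.

End Hoelder.

Lemma limit_bij : bijective g.
Proof.
have /choice[f fg] := limit_surj.
exists f => // x; have := fg (g x); set y := f (g x) => E.
have E0 k : enorm (G k y - G k x) <= 4 * kap * t ^+ k.
  have := dist_limit k y x; rewrite E subrr enorm0 sub0r normrN.
  by rewrite ger0_norm ?enorm_ge0.
apply/eqP; rewrite -subr_eq0; apply/eqP/enorm0_eq0/eqP.
rewrite eq_le enorm_ge0 andbT.
apply: (@le0_geometric _ _ (4 * kap) 5^-1); [slra|slra|] => k.
apply: le_trans (compose_lower_half k _ _) _.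
have h3 : 0 <= 2 ^+ k :> R by rewrite exprn_ge0.
apply: le_trans (ler_wpM2l h3 (E0 k)) _; have -> : 5^-1 = 2 * t :> R by slra.
by rewrite exprMn mulrCA.
Qed.

End Assembly.

(** * Reifenberg parametrization *)

Section Construction.
Context {R : realType} {n : nat}.
Implicit Types (x y z u v : 'rV[R]_n) (q : 'M[R]_n) (E S : set 'rV[R]_n).
Local Notation t := (10^-1 : R).

Lemma smoothing_sequence d E (p : nat -> 'rV[R]_n -> 'M[R]_n) (p0 : 'M[R]_n) (eps : R) :
  (0 < n)%N -> 0 <= eps -> flat_cst (n := n) * eps <= 100^-1 / 10 ->
  (forall x, E x -> enorm x <= 1) -> E 0 ->
  (forall k, coherent d E eps (t ^+ k) (p k)) ->
  (forall k x, E x -> opnorm_le (p k x - p k.+1 x) (6 * eps)) ->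
  projd d p0 -> opnorm_le (p 0%N 0 - p0) (6 * eps) ->
  exists D : nat -> 'rV[R]_n -> 'rV[R]_n,
    let S k := [set compose_perturbations D k y | y in plane 0 p0] in
    forall k, [/\ lipschitz_with (disp_cst (n := n) * eps) (D k),
      forall x, enorm (D k x) <= disp_cst (n := n) * eps * t ^+ k,
      graph_near E (S k) (graph_cst (n := n) * eps) (t ^+ k) (p k) &
      flat_everywhere d (S k) (t ^+ k) (flat_cst (n := n) * eps)].
Proof.
move=> n0 eps0 small E1 E0 coh step p0d p0p.
pose Inv k S := graph_near E S (graph_cst (n := n) * eps) (t ^+ k) (p k) /\
  flat_everywhere d S (t ^+ k) (flat_cst (n := n) * eps).
(* [D k] depends on the set built by the previous maps. Choosing a map for every pair of a scale and
   a set, zero where the invariant fails, lets the recursion be written before the invariant is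
   proved along it. *)
have /choice[F hF] : forall kS : nat * set 'rV[R]_n, exists D : 'rV[R]_n -> 'rV[R]_n,
    Inv kS.1 kS.2 ->
    [/\ lipschitz_with (disp_cst (n := n) * eps) D,
        forall x, enorm (D x) <= disp_cst (n := n) * eps * t ^+ kS.1 &
        Inv kS.1.+1 [set x + D x | x in kS.2]].
  move=> [k S] /=; have [[gr fl]|nI] := pselect (Inv k S); last by exists (fun=> 0).
  have tk0 : 0 < t ^+ k by rewrite exprn_gt0; lra.
  have tk1 : t ^+ k <= 1 by rewrite exprn_ile1 //; lra.
  have pp' x : E x -> projd d (p k.+1 x) /\ opnorm_le (p k x - p k.+1 x) (6 * eps).
    by move=> Ex; split; [exact: (coh k.+1).1|exact: step].
  have [D [h1 h2 h3 h4]] := induction_step n0 eps0 small tk0 tk1 E1 (coh k) pp' gr fl.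
  by exists D => _; split => //; split; rewrite exprSr.
pose S := fix S k := if k is k'.+1 then [set x + F (k', S k') x | x in S k'] else plane 0 p0.
pose D k := F (k, S k).
have SI k : Inv k (S k).
  elim: k => [|k IH] /=; last by have [] := hF (k, S k) IH.
  by rewrite /Inv expr0; apply: induction_base => //; have := coh 0%N; rewrite expr0.
have SE k : S k = [set compose_perturbations D k y | y in plane 0 p0].
  elim: k => [|k IH] /=; first by rewrite image_id.
  rewrite {1}IH; apply/seteqP; split=> y.
    by move=> [_ [z hz <-] <-]; exists z.
  by move=> [z hz <-]; exists (compose_perturbations D k z) => //; exists z.
exists D => /= k; rewrite -SE; have [h1 h2 _] := hF (k, S k) (SI k).
by have [h3 h4] := SI k.
Qed.

End Construction.

(** For r >= 1 the plane parallel to im p0 works, as [g] moves points by at most 2 kap. For r < 1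
    the graph of the k-th surface is used at a scale between r and 10 r, whence the factor 10; the
    cone condition over a length 3/2 s gives 3 lam, and the displacements of two points give 4
    kap. *)
Lemma reifenberg_flat_limit (R : realType) n d (D : nat -> 'rV[R]_n -> 'rV[R]_n)
    (p0 : 'M[R]_n) (g : 'rV[R]_n -> 'rV[R]_n) (kap lam : R) :
  let t : R := 10^-1 in let G := compose_perturbations D in
  let Sigma := [set g y | y in plane 0 p0] in
  0 <= kap -> kap <= 100^-1 -> 0 <= lam -> lam <= 2^-1 -> projd d p0 ->
  (forall k x, enorm (g x - G k x) <= 2 * kap * t ^+ k) ->
  (forall k, flat_everywhere d [set G k y | y in plane 0 p0] (t ^+ k) lam) ->
  forall x (r : R), Sigma x -> 0 < r ->
    exists q, projd d q /\
      (local_hdist x r Sigma (plane x q) <= (10 * (3 * lam + 4 * kap))%:E)%E.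
Proof.
move=> t G Sigma kap0 kap1 lam0 lam2 p0d gG flat x r [w Pw <-] r0.
have gk k y : enorm (g y - G k y) <= 2 * kap * t ^+ k by exact: gG.
have inP v : plane 0 p0 (w + v *m p0).
  have [a _ <-] := Pw; exists (a + v) => //; mxlin.
have kl : 4 * kap <= 10 * (3 * lam + 4 * kap) by lra.
have [r1|r1] := leP 1 r.
  have g0 y : enorm (g y - y) <= 2 * kap by have := gk 0%N y; rewrite expr0 mulr1.
  exists p0; split => //; apply: local_hdist_le => // y.
    move=> [w' [a _ <-] <-] _; have [b _ wE] := Pw.
    exists (g w + (a - b) *m p0); first by exists (a - b).
    have -> : g (0 + a *m p0) - (g w + (a - b) *m p0) =
      (g (0 + a *m p0) - (0 + a *m p0)) - (g w - w) 
        by move: (g w) (g (0 + a *m p0)) => u v; rewrite -wE; mxlin.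
    apply: le_trans (enormB _ _) _; have := g0 w; have := g0 (0 + a *m p0); nra.
  move=> [v _ <-] _; exists (g (w + v *m p0)); first by exists (w + v *m p0).
  have -> : g w + v *m p0 - g (w + v *m p0) =
    (g w - w) - (g (w + v *m p0) - (w + v *m p0)) by mxlin.
  by apply: le_trans (enormB _ _) _; have := g0 w; have := g0 (w + v *m p0); nra.
have [k [k1 k2]] := geometric_scale r0 (ltW r1).
set s := 10^-1 ^+ k in k2; have s0 : 0 < s by rewrite exprn_gt0; lra.
have sr : s <= 10 * r by rewrite exprS -/s in k1; lra.
have {}gk y : enorm (g y - G k y) <= 2 * kap * s by exact: gk.
have kaps : kap * s <= 100^-1 * s by rewrite ler_wpM2r // ltW.
have [q qd ql] : exists2 q, projd d q & lgraph [set G k y | y in plane 0 p0] (G k w) (3 * s) q lam.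
  by apply: flat; exists w.
have Sw : [set G k y | y in plane 0 p0] (G k w) by exists w.
exists q; split=> //; apply: local_hdist_le => // y.
  move=> [w' Pw' <-] yx.
  have Sw' : [set G k y | y in plane 0 p0] (G k w') by exists w'.
  exists (g w + (g w' - g w) *m q); first by exists (g w' - g w).
  have -> : g w' - (g w + (g w' - g w) *m q) = (g w' - g w) *m (1%:M - q) by mxlin.
  have -> : (g w' - g w) *m (1%:M - q) = (G k w' - G k w) *m (1%:M - q) +
    ((g w' - G k w') - (g w - G k w)) *m (1%:M - q) by mxlin.
  have h1 := enormB (g w' - G k w') (g w - G k w).
  have h2 := projC_le ((g w' - G k w') - (g w - G k w)) qd.1.
  have h3 : enorm (G k w' - G k w) <= 3 / 2 * s.
    have -> : G k w' - G k w = (g w' - g w) - ((g w' - G k w') - (g w - G k w)) by mxlin.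
    by apply: le_trans (enormB _ _) _; have := gk w; have := gk w'; lra.
  have h4 : enorm ((G k w' - G k w) *m (1%:M - q)) <= 2 * lam * enorm (G k w' - G k w).
    apply: (lgraph_cone qd.1 lam0 lam2 ql Sw' Sw); first by lra.
    by rewrite subrr enorm0; lra.
  have h5 := ler_wpM2l lam0 h3; have h6 := ler_wpM2l lam0 sr; have h7 := ler_wpM2l kap0 sr.
  by apply: le_trans (enormD _ _) _; have := gk w; have := gk w'; lra.
move=> [v _ <-]; have -> : g w + v *m q - g w = v *m q by mxlin.
move=> vr.
have [|_ [w' Pw' <-] h] := lgraph_cover qd.1 lam0 lam2 ql Sw (v := v).
  by rewrite subrr enorm0; lra.
exists (g w'); first by exists w'.
have -> : g w + v *m q - g w' = (G k w + v *m q - G k w') + ((g w - G k w) - (g w' - G k w')) by mxlin.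
apply: le_trans (enormD _ _) _; have := enormB (g w - G k w) (g w' - G k w').
have h5 := ler_wpM2l lam0 vr; have h7 := ler_wpM2l kap0 sr.
have h8 : 0 <= lam * r by rewrite mulr_ge0 // ltW.
by have := gk w; have := gk w'; lra.
Qed.

Lemma expz10N (R : realType) (k : nat) : (10 : R) ^ (- k%:Z) = 10^-1 ^+ k.
Proof. by rewrite -exprz_inv -exprnP. Qed.

Lemma expz10ND (R : realType) (k j : nat) : (10 : R) ^ (- k%:Z + j%:Z) = 10^-1 ^+ k * 10 ^+ j.
Proof. by rewrite expfzDr ?expz10N // pnatr_eq0. Qed.

Theorem theorem1p10 (R : realType) (n d : nat) (hd : (0 < d)%N)
    (hdn : (d < n)%N) :
  exists C : R, forall tau : R, 0 < tau -> tau < 10^-1 ->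
  exists eps : R, 0 < eps /\
  forall (E : set 'rV[R]_n) (P : 'rV[R]_n -> R -> set 'rV[R]_n),
    closed E -> E `<=` eball 0 1 -> E 0 ->
    (forall (x : 'rV[R]_n) (r : R), E x -> 0 < r -> r <= 10 ->
       [/\ affine_plane d (P x r), P x r x &
           forall y : 'rV[R]_n, E y -> eball x r y ->
             (edist_to y (P x r) <= (eps * r)%:E)%E]) ->
    (forall (x : 'rV[R]_n) (k : nat), E x ->
       ((local_hdist x (10 ^ (- k%:Z))
           (P x (10 ^ (- k%:Z))) (P x (10 ^ (- k%:Z + 1))))%R <= eps%:E)%E) ->
    (forall (x y : 'rV[R]_n) (k : nat), E x -> E y ->
       enorm (x - y) <= 10 ^ (- k%:Z + 2) ->
       ((local_hdist x (10 ^ (- k%:Z + 2))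
           (P x (10 ^ (- k%:Z))) (P y (10 ^ (- k%:Z))))%R <= eps%:E)%E) ->
    exists g : 'rV[R]_n -> 'rV[R]_n,
      [/\ bijective g,
          forall x : 'rV[R]_n, enorm (g x - x) <= tau,
          forall x y : 'rV[R]_n, enorm (x - y) <= 1 ->
            4^-1 * enorm (x - y) `^ (1 + tau) <= enorm (g x - g y) /\
            enorm (g x - g y) <= 3 * enorm (x - y) `^ (1 - tau),
          E `<=` g @` P 0 10 &
          forall (x : 'rV[R]_n) (r : R), (g @` P 0 10) x -> 0 < r ->
            exists Q : set 'rV[R]_n,
              [/\ affine_plane d Q, Q x &
                  ((local_hdist x r (g @` P 0 10) Q)%R <= (C * eps)%:E)%E]].
Proof.
have n0 : (0 < n)%N by exact: leq_ltn_trans hdn.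
pose flat : R := flat_cst (n := n); pose disp : R := disp_cst (n := n).
have graph_ge : 10 * 260 <= graph_cst (n := n) :> R := graph_cst_ge.
have disp_ge := disp_cst_ge (R := R) n0.
have flatE : flat = graph_cst (n := n) + 2 * disp by [].
rewrite -/disp in disp_ge; have disp0 : 0 < disp by lra.
(* The constant of [reifenberg_flat_limit] for lam = flat eps and kap = disp eps, fixed before
   [tau]. *)
exists (10 * (3 * flat + 4 * disp)) => tau tau0 tau1.
pose t : R := 10^-1; have t0 : 0 < t by rewrite /t; lra.
have T1 : t `^ tau < 1.
  have := @gt0_ltr_powR R tau tau0 t 1; rewrite powR1; apply; rewrite ?nnegrE /t; lra.
(* The first term serves both Hoelder conditions, the second the bound on |g x - x|, the third the
   smallness required by the construction. *)
pose e := Num.min ((1 - t `^ tau) / 2) (Num.min tau 100^-1).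
have e0 : 0 < e by rewrite !lt_min tau0 divr_gt0 ?subr_gt0 // invr_gt0; lra.
have : e <= e by []; rewrite {2}/e !le_min => /and3P[e1 e2 e3].
(* Since flat <= 3 disp, the divisor 30 yields flat eps <= e / 10 <= 1/1000. *)
pose eps := e / (30 * disp).
have eps0 : 0 < eps by rewrite divr_gt0 // mulr_gt0.
have depsE : disp * eps = e / 30.
  by rewrite /eps; field; rewrite gt_eqF.
have feps : flat * eps <= 100^-1 / 10.
  have : graph_cst (n := n) * eps <= disp * eps by rewrite ler_wpM2r ?ltW //; lra.
  have -> : flat * eps = graph_cst (n := n) * eps + 2 * (disp * eps) by rewrite flatE; ring.
  by rewrite depsE; lra.
have flat_ge : 10 * 260 <= flat by rewrite flatE; lra.
have feps0 : 0 <= flat * eps by rewrite mulr_ge0 ?(ltW eps0) //; lra.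
have eps2 : eps <= 2^-1.
  have : 10 * 260 * eps <= flat * eps by rewrite ler_wpM2r // ltW.
  lra.
exists eps; split=> // E P _ E1' E0 HP Hk Hxy.
have E1 x : E x -> enorm x <= 1 by move=> /E1' /=; rewrite /eball /= subr0.
have t_le k : 0 < t ^+ k /\ t ^+ k <= 10.
  split; first by rewrite exprn_gt0.
  by apply: (@le_trans _ _ 1); [rewrite exprn_ile1 // ?ltW // /t; lra|lra].
have /choice[p hp] : forall kx : nat * 'rV[R]_n, exists p : 'M[R]_n, E kx.2 ->
    projd d p /\ P kx.2 (t ^+ kx.1) = plane kx.2 p.
  move=> [k x] /=; have [Ex|nEx] := pselect (E x); last by exists 0.
  have [k0 k10] := t_le k; have [aP Px _] := HP _ _ Ex k0 k10.
  by have [p hp] := affine_planeP aP Px; exists p.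
have ten0 : 0 < 10 :> R by lra.
have [aP Px _] := HP _ _ E0 ten0 (lexx _).
have [p0 [p0d PE]] := affine_planeP aP Px.
have coh k : coherent d E eps (t ^+ k) (fun x => p (k, x)).
  split=> [x Ex|x y Ex Ey xy]; first by have [] := hp (k, x) Ex.
  have [pxd PxE] := hp (k, x) Ex; have [pyd PyE] := hp (k, y) Ey; rewrite /= in PxE PyE.
  have r0 : 0 < t ^+ k * 10 ^+ 2 by rewrite mulr_gt0 ?exprn_gt0.
  (* Both orders are used: the comparison centred at [x] gives the angle, the one centred at [y] the
     offset of [y] from the plane at [x]. *)
  have h1 := Hxy x y k Ex Ey; rewrite (expz10ND _ k 2) expz10N -/t PxE PyE in h1.
  have h2 := Hxy y x k Ey Ex; rewrite (expz10ND _ k 2) expz10N -/t PxE PyE in h2.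
  have rE : t ^+ k * 10 ^+ 2 = 100 * t ^+ k by rewrite mulrC; congr (_ * _); ring.
  rewrite rE in r0 h1 h2.
  have [_ hxy] := local_hdist_plane pxd.1 pyd.1 r0 eps2 (h1 xy).
  rewrite enormC in h2; have [hyx _] := local_hdist_plane pyd.1 pxd.1 r0 eps2 (h2 xy).
  by split=> //; apply: le_trans hyx _; rewrite mulrA (mulrC eps).
have step k x : E x -> opnorm_le (p (k, x) - p (k.+1, x)) (6 * eps).
  move=> Ex; have [pxd PxE] := hp (k, x) Ex; have [pyd PyE] := hp (k.+1, x) Ex.
  (* At index k + 1 the hypothesis compares scales k + 1 and k; index 0 is the comparison of P(0,1)
     with P(0,10). *)
  rewrite /= in PxE PyE; have h := Hk x k.+1 Ex.
  rewrite (expz10ND _ k.+1 1) expz10N -/t PyE exprSr -mulrA mulVf ?gt_eqF // mulr1 PxE in h.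
  have r0 : 0 < t ^+ k * t by rewrite mulr_gt0 ?exprn_gt0.
  by apply: opnormC; have [_] := local_hdist_plane pyd.1 pxd.1 r0 eps2 h.
have p0p : opnorm_le (p (0%N, 0) - p0) (6 * eps).
  have [pxd PxE] := hp (0%N, 0) E0; rewrite /= in PxE; have h := Hk 0 0%N E0.
  rewrite (expz10ND _ 0%N 1) expz10N -/t PxE expr0 mul1r expr1 PE in h.
  by have [_] := local_hdist_plane pxd.1 p0d.1 ltr01 eps2 h.
have [D hD] := smoothing_sequence n0 (ltW eps0) feps E1 E0 coh step p0d p0p.
pose kap := disp * eps.
have kap0 : 0 <= kap by rewrite /kap depsE; lra.
have kap1 : kap <= 100^-1 by rewrite /kap depsE; lra.
have DL k : lipschitz_with kap (D k) by have [] := hD k.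
have Db k x : enorm (D k x) <= kap * 10^-1 ^+ k by have [_ + _ _] := hD k; exact.
have [g gG] := compose_limit kap0 kap1 Db.
have kap_up : (1 + kap) * (10^-1 : R) `^ tau <= 1.
  by rewrite -/t /kap depsE; have := powR_ge0 t tau; nra.
have kap_low : (10^-1 : R) `^ tau <= (1 - kap) ^+ 2.
  by rewrite -/t /kap depsE; nra.
have tau1' : tau < 1 by lra.
exists g; rewrite PE; split.
- exact: (limit_bij kap0 kap1 DL Db gG).
- move=> x; have := gG 0%N x; rewrite expr0 mulr1 => h; apply: le_trans h _.
  by rewrite /kap depsE; lra.
- by move=> x y xy; split; 
    [exact: (limit_lower kap0 kap1 DL gG tau0 tau1' kap_low xy)|
     exact: (limit_upper kap0 kap1 DL gG tau0 kap_up xy)].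
- move=> x Ex; have [|v ->] := limit_mem kap0 kap1 DL Db gG (p := p0) (x := x) _ p0d.1.
    move=> k; have [_ _ gr _] := hD k; have [_ _ [_ [_ [v _ <-] <-] h]] := gr _ Ex.
    by exists v; rewrite enormC -[X in compose_perturbations D k X]add0r.
  by exists (v *m p0) => //; exists v; rewrite ?add0r.
- move=> x r Sx r0.
  have hflat k : flat_everywhere d [set compose_perturbations D k y | y in plane 0 p0]
      (10^-1 ^+ k) (flat * eps) by have [] := hD k.
  have lam2 : flat * eps <= 2^-1 by lra.
  have [q [qd qh]] := reifenberg_flat_limit kap0 kap1 feps0 lam2 p0d gG hflat Sx r0.
  exists (plane x q); split; first exact: qd.2.
    by exists 0; rewrite // mul0mx addr0.
  by apply: le_trans qh _; rewrite lee_fin /kap le_eqVlt; apply/orP; left; apply/eqP; ring.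
Qed.
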